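(* Let $\Theta$ be a free holomorphic function on $[B(\mathcal H)^n]_1$ with coefficients in $B(\mathcal E,\mathcal Y)$. Then the map $$\varphi(r):=\Theta(rR_1,\dots,rR_n)^*\Theta(rR_1,\dots,rR_n),\qquad r\in[0,1),$$ is a sub-pluriharmonic curve in the tensor algebra $B(\mathcal E)\otimes_{min}C^*(R_1,\dots,R_n)$.
   Context: Let $n\ge 1$; $\mathcal E,\mathcal Y$ are Hilbert spaces ($\mathcal E$ separable) and $\mathcal H$ is an infinite dimensional Hilbert space. $\mathbb F_n^+$ is the free unital semigroup on $g_1,\dots,g_n$ with identity $g_0$, $|\alpha|$ is word length, and $\tilde\alpha=g_{i_k}\cdots g_{i_1}$ is the reverse of $\alpha=g_{i_1}\cdots g_{i_k}$. For operators $X_1,\dots,X_n$, $X_\alpha=X_{i_1}\cdots X_{i_k}$, $X_{g_0}=I$. $H_n$ is an $n$-dimensional complex Hilbert space with orthonormal basis $e_1,\dots,e_n$, $F^2(H_n)=\mathbb C1\oplus\bigoplus_{k\ge1}H_n^{\otimes k}$, with orthonormal basis $e_\alpha=e_{i_1}\otimes\cdots\otimes e_{i_k}$, $e_{g_0}=1$; $R_i\varphi=\varphi\otimes e_i$ are the right creation operators, $R=(R_1,\dots,R_n)$. For any Hilbert space $\mathcal H$, $[B(\mathcal H)^n]_1=\{(X_1,\dots,X_n)\in B(\mathcal H)^n:\|\sum_iX_iX_i^*\|^{1/2}<1\}$. A free holomorphic function on $[B(\mathcal H)^n]_1$ with coefficients in $B(\mathcal E,\mathcal Y)$ is a map $\Theta(X)=\sum_{k=0}^\infty\sum_{|\alpha|=k}A_{(\alpha)}\otimes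 X_\alpha$ with $A_{(\alpha)}\in B(\mathcal E,\mathcal Y)$ and $\limsup_k\|\sum_{|\alpha|=k}A_{(\alpha)}^*A_{(\alpha)}\|^{1/2k}\le1$; it is evaluated at $(rR_1,\dots,rR_n)$ by the same (norm convergent) series. Sub-pluriharmonic curves with respect to the right creation operators: for $X\in[B(\mathcal H)^n]_1$ let $\Delta_X=(I-\sum_iX_iX_i^* )^{1/2}$, $K_Xh=\sum_{\alpha}e_{\tilde\alpha}\otimes\Delta_XX_\alpha^*h$ for $h\in\mathcal H$, and $\mathbf P_X[u]=(I_{\mathcal E}\otimes K_X^* )(u\otimes I_{\mathcal H})(I_{\mathcal E}\otimes K_X)$ for $u\in B(\mathcal E\otimes F^2(H_n))$ (so that $\mathbf P_X[A\otimes R_\alpha R_\beta^*]=A\otimes X_\alpha X_\beta^*$). Let $\mathcal S$ be the operator norm closure in $B(\mathcal E\otimes F^2(H_n))$ of $\boldsymbol{\mathcal P}^*+\boldsymbol{\mathcal P}$, where $\boldsymbol{\mathcal P}=B(\mathcal E)\otimes\{\text{polynomials in }R_1,\dots,R_n,I\}$. For $J=[0,\gamma)$ or $[0,\gamma]$, a map $\varphi:J\to\mathcal S$ is a pluriharmonic curve if $\varphi(r)=\mathbf P_{\frac rtR}[\varphi(t)]$ for all $r<t$ in $J$. A map $\psi:[0,1)\to\mathcal S$ with $\psi(r)=\psi(r)^*$ is a sub-pluriharmonic curve in $B(\mathcal E)\otimes_{min}C^*(R_1,\dots,R_n)$ if for each $\gamma\in(0,1)$ and each self-adjoint-valued pluriharmonic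 curve $\varphi:[0,\gamma]\to\mathcal S$, $\psi(\gamma)\le\varphi(\gamma)$ implies $\psi(r)\le\varphi(r)$ for all $r\in[0,\gamma]$. *)

(* Defs.v *)
From HB Require Import structures.
From mathcomp Require Import all_boot all_order all_algebra.
From mathcomp Require Import complex.
From mathcomp Require Import all_classical all_reals all_analysis.

Set Implicit Arguments.
Unset Strict Implicit.
Unset Printing Implicit Defensive.

Import Order.TTheory GRing.Theory Num.Theory.
Import numFieldNormedType.Exports.

Local Open Scope classical_set_scope.
Local Open Scope ring_scope.
Local Open Scope complex_scope.

(* The inner product is linear in its first argument.  The norm of a vector
   is an element of R[i], as always for a normed module over R[i].  *)
HB.mixin Record isHilbert (R : realType) H of CompleteNormedModule R[i] H := {
  hdot : {dot H for (@Num.conj R[i])} ;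
  hdotE : forall x : H, `|x| ^+ 2 = hdot x x
}.

#[short(type="hilbertType")]
HB.structure Definition Hilbert (R : realType) :=
  { H of CompleteNormedModule R[i] H & isHilbert R H }.

Section hilbert_spaces.
Context {R : realType} {H : hilbertType R}.

Definition hspan (S : set H) : set H :=
  [set v | exists (m : nat) (c : 'I_m -> R[i]) (s : 'I_m -> H),
     (forall i, S (s i)) /\ v = \sum_(i < m) c i *: s i].

Definition total (S : set H) := closure (hspan S) = [set: H].

Definition orthonormal_basis (I : eqType) (e : I -> H) :=
  (forall i j, hdot (e i) (e j) = (i == j)%:R) /\ total (range e).

End hilbert_spaces.

Definition separable {R : realType} (H : hilbertType R) :=
  exists D : set H, countable D /\ dense D.

Definition infinite_dimensional {R : realType} (H : hilbertType R) :=
  forall (m : nat) (s : 'I_m -> H), hspan (range s) <> [set: H].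

Section bounded_operators.
Context {R : realType} (H K : hilbertType R).

Definition bounded_linear : {pred H -> K} := fun f => `[< linear f /\
  exists M : R, forall x, `|f x| <= M%:C * `|x| >].

Record bop := Bop { bop_fun :> H -> K ; bopP : bop_fun \in bounded_linear }.

HB.instance Definition _ := [isSub for bop_fun].
HB.instance Definition _ := [Choice of bop by <:].

Lemma bounded_linearP (f : H -> K) : reflect
  (linear f /\ exists M : R, forall x, `|f x| <= M%:C * `|x|)
  (f \in bounded_linear).
Proof. exact: asboolP. Qed.

Lemma bop_bounded (f : bop) : exists M : R, forall x, `|f x| <= M%:C * `|x|.
Proof. by have /bounded_linearP[] := bopP f. Qed.

Lemma bop_linear (f : bop) : linear f.
Proof. by have /bounded_linearP[] := bopP f. Qed.

HB.instance Definition _ (f : bop) :=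
  GRing.isLinear.Build R[i] H K *:%R f (@bop_linear f).

Lemma bounded_linear_submod : submod_closed bounded_linear.
Proof.
split.
  apply/bounded_linearP; split; first by move=> a x y; rewrite scaler0 addr0.
  by exists 0 => x; rewrite normr0 mul0r.
move=> a f g /bounded_linearP[fl [M fM]] /bounded_linearP[gl [N gN]].
apply/bounded_linearP; split.
  move=> b x y; change (a *: f (b *: x + y) + g (b *: x + y) =
    b *: (a *: f x + g x) + (a *: f y + g y)).
  rewrite fl gl !scalerDr !scalerA (mulrC a) -!addrA; congr (_ + _).
  by rewrite addrCA.
exists (complex.Re `|a| * M + N) => x.
change (`|a *: f x + g x| <= (complex.Re `|a| * M + N)%:C * `|x|).
have -> : (complex.Re `|a| * M + N)%:C = `|a| * M%:C + N%:C.
  by rewrite rmorphD rmorphM; congr (_ * _ + _); rewrite [LHS]RRe_real.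
rewrite (le_trans (ler_normD _ _))// mulrDl lerD// normrZ -mulrA.
by rewrite ler_wpM2l.
Qed.

HB.instance Definition _ :=
  GRing.isSubmodClosed.Build R[i] (H -> K) bounded_linear bounded_linear_submod.
HB.instance Definition _ := [SubChoice_isSubLmodule of bop by <:].

Definition opnorm (A : bop) : R :=
  sup [set complex.Re `|A x| | x in [set x : H | `|x| <= 1]].

Definition opcvg (A : nat -> bop) (L : bop) :=
  opnorm (A N - L) @[N --> \oo] --> (0 : R).

End bounded_operators.

Notation "''B' ( H , K )" := (bop H K) (format "''B' ( H ,  K )").

Section operator_algebra.
Context {R : realType}.
Implicit Types H K L : hilbertType R.

Lemma bop_id_subproof H : (id : H -> H) \in @bounded_linear R H H.
Proof.
apply/bounded_linearP; split; first by [].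
by exists 1 => x; rewrite mul1r.
Qed.

Definition bop_id H : 'B(H, H) := Bop (bop_id_subproof H).

Lemma bop_comp_subproof H K L (A : 'B(K, L)) (B : 'B(H, K)) :
  A \o B \in @bounded_linear R H L.
Proof.
apply/bounded_linearP; split; first by move=> a x y; rewrite /= !linearP.
have [M AM] := bop_bounded A; have [N BN] := bop_bounded B.
exists (`|M| * `|N|) => x /=.
have leN (m : R) (z : R[i]) : 0 <= z -> m%:C * z <= `|m|%:C * z.
  by move=> z0; rewrite ler_wpM2r// lecR ler_norm.
apply: (le_trans (AM _)); apply: (le_trans (leN _ _ (normr_ge0 _))).
rewrite rmorphM -mulrA ler_wpM2l ?lecR//.
by apply: (le_trans (BN _)); exact: leN.
Qed.

Definition bop_comp H K L (A : 'B(K, L)) (B : 'B(H, K)) : 'B(H, L) :=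
  Bop (bop_comp_subproof A B).

(* Here and below, an operator given by a property that is satisfied by a unique
   bounded operator is selected with xget; its default value 0 is only reached
   outside of the intended domain (e.g. for the square root of an operator that
   is not positive). *)
Definition adj H K (A : 'B(H, K)) : 'B(K, H) :=
  xget 0 [set B : 'B(K, H) | forall x y, hdot (A x) y = hdot x (B y)].

(* The order of R[i] only compares numbers with the same imaginary part, so
   bop_le 0 A says that every <A x, x> is real and nonnegative. *)
Definition bop_le H (A B : 'B(H, H)) :=
  forall x : H, hdot (A x) x <= hdot (B x) x.

(* On a complex Hilbert space a positive operator is self-adjoint. *)
Definition bop_sqrt H (A : 'B(H, H)) : 'B(H, H) :=
  xget 0 [set D : 'B(H, H) | bop_le 0 D /\ bop_comp D D = A].

(* The word g_{i_1} ... g_{i_k} is the sequence [:: i_1; ...; i_k]. *)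
Fixpoint bop_word H n (X : 'I_n -> 'B(H, H)) (w : seq 'I_n) : 'B(H, H) :=
  if w is i :: w' then bop_comp (X i) (bop_word X w') else bop_id H.

Definition op_ball H n : set ('I_n -> 'B(H, H)) :=
  [set X | Num.sqrt (opnorm (\sum_(i < n) bop_comp (X i) (adj (X i)))) < 1].

End operator_algebra.

Infix "\ob" := bop_comp (at level 40, left associativity) : ring_scope.

(* A choice of Hilbert space tensor products: the elementary tensors have the
   usual inner products and span a dense subspace, which determines H (x) K up
   to a unique unitary equivalence. *)
Record tensor_product (R : realType) := TensorProduct {
  tens : hilbertType R -> hilbertType R -> hilbertType R ;
  tmul : forall H K : hilbertType R, {bilinear H -> K -> tens H K} ;
  hdot_tmul : forall (H K : hilbertType R) (x x' : H) (y y' : K),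
    hdot (tmul H K x y) (tmul H K x' y') = hdot x x' * hdot y y' ;
  total_tmul : forall H K : hilbertType R,
    total [set tmul H K p.1 p.2 | p in [set: H * K]] }.

Section tensor_products.
Context {R : realType} (T : tensor_product R).
Implicit Types H K L : hilbertType R.

Definition bop_tens H K H' K' (A : 'B(H, H')) (B : 'B(K, K')) :
    'B(tens T H K, tens T H' K') :=
  xget 0 [set U : 'B(tens T H K, tens T H' K') |
    forall x y, U (tmul T H K x y) = tmul T H' K' (A x) (B y)].

(* The identifications between H (x) (K (x) L) and (H (x) K) (x) L. *)
Definition tens_assoc H K L :
    'B(tens T H (tens T K L), tens T (tens T H K) L) :=
  xget 0 [set U : 'B(_, _) | forall x y z,
    U (tmul T _ _ x (tmul T _ _ y z)) = tmul T _ _ (tmul T _ _ x y) z].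

Definition tens_assocV H K L :
    'B(tens T (tens T H K) L, tens T H (tens T K L)) :=
  xget 0 [set U : 'B(_, _) | forall x y z,
    U (tmul T _ _ (tmul T _ _ x y) z) = tmul T _ _ x (tmul T _ _ y z)].

(* tens_power H k is the tensor power of H of order k + 1. *)
Fixpoint tens_power H (k : nat) : hilbertType R :=
  if k is k'.+1 then tens T (tens_power H k') H else H.

End tensor_products.

(* The full Fock space, as a Hilbert direct sum of C 1 and of the tensor powers
   of H. *)
Record fock_space (R : realType) (T : tensor_product R) (H : hilbertType R) :=
  FockSpace {
  fock :> hilbertType R ;
  fock_vac : fock ;
  fock_inj : forall k, {linear tens_power T H k -> fock} ;
  hdot_vac : hdot fock_vac fock_vac = 1 ;
  hdot_fock_inj : forall k x y,
    hdot (fock_inj k x) (fock_inj k y) = hdot x y ;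
  hdot_fock_inj_neq : forall k l x y, k != l ->
    hdot (fock_inj k x) (fock_inj l y) = 0 ;
  hdot_vac_inj : forall k x, hdot fock_vac (fock_inj k x) = 0 ;
  total_fock : total ([set fock_vac] `|` \bigcup_k range (fock_inj k)) }.

Section fock_spaces.
Context {R : realType} {T : tensor_product R} {n : nat} {Hn : hilbertType R}.
Variables (e : 'I_n -> Hn) (F : fock_space T Hn).

(* For s = [:: i_k; ...; i_2], this is e_{i_1} (x) e_{i_2} (x) ... (x) e_{i_k},
   where i_1 = i. *)
Fixpoint basis_tensor (i : 'I_n) (s : seq 'I_n) : tens_power T Hn (size s) :=
  if s is j :: s' then tmul T _ Hn (basis_tensor i s') (e j) else e i.

Definition fock_basis (w : seq 'I_n) : F :=
  if w is i :: w' then fock_inj F _ (basis_tensor i (rev w')) else fock_vac F.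

(* The right creation operator phi |-> phi (x) e_i. *)
Definition right_creation (i : 'I_n) : 'B(F, F) :=
  xget 0 [set U : 'B(F, F) | U (fock_vac F) = fock_inj F 0%N (e i) /\
    forall k x, U (fock_inj F k x) = fock_inj F k.+1 (tmul T _ _ x (e i))].

Definition scaled_creation (r : R) (i : 'I_n) : 'B(F, F) :=
  r%:C *: right_creation i.

Section poisson.
Context {E H : hilbertType R}.
Variable X : 'I_n -> 'B(H, H).

Definition defect : 'B(H, H) :=
  bop_sqrt (bop_id H - \sum_(i < n) X i \ob adj (X i)).

Definition poisson_kernel : 'B(H, tens T F H) :=
  xget 0 [set K : 'B(H, tens T F H) | forall h,
    \sum_(k < N) \sum_(w : k.-tuple 'I_n)
      tmul T F H (fock_basis (rev w)) (defect (adj (bop_word X w) h))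
    @[N --> \oo] --> K h].

Definition poisson (u : 'B(tens T E F, tens T E F)) :
    'B(tens T E H, tens T E H) :=
  bop_tens T (bop_id E) (adj poisson_kernel) \ob tens_assocV T E F H
  \ob bop_tens T u (bop_id H)
  \ob tens_assoc T E F H \ob bop_tens T (bop_id E) poisson_kernel.

End poisson.

Section curves.
Variable E : hilbertType R.
Local Notation opEF := 'B(tens T E F, tens T E F).

(* B(E) (x) {polynomials in R_1, ..., R_n and I} *)
Definition creation_polynomials : set opEF :=
  [set p | exists s : seq ('B(E, E) * seq 'I_n),
     p = \sum_(a <- s) bop_tens T a.1 (bop_word right_creation a.2)].

Definition harmonic_operators : set opEF :=
  [set u | forall eps : R, 0 < eps -> exists p q : opEF,
     [/\ creation_polynomials p, creation_polynomials q
       & opnorm (u - (adj p + q)) < eps]].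

Definition pluriharmonic_curve (J : set R) (phi : R -> opEF) :=
  (forall r, J r -> harmonic_operators (phi r)) /\
  (forall r t, J r -> J t -> r < t ->
     phi r = poisson (scaled_creation (r / t)) (phi t)).

Definition sub_pluriharmonic_curve (psi : R -> opEF) :=
  (forall r, 0 <= r < 1 ->
     harmonic_operators (psi r) /\ adj (psi r) = psi r) /\
  (forall gamma : R, 0 < gamma < 1 -> forall phi : R -> opEF,
     pluriharmonic_curve `[0, gamma] phi ->
     (forall r, 0 <= r <= gamma -> adj (phi r) = phi r) ->
     bop_le (psi gamma) (phi gamma) ->
     forall r, 0 <= r <= gamma -> bop_le (psi r) (phi r)).

End curves.
End fock_spaces.

Section free_holomorphic.
Context {R : realType} (T : tensor_product R) {n : nat} {E Y : hilbertType R}.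

Definition free_series (A : seq 'I_n -> 'B(E, Y)) (H : hilbertType R)
    (X : 'I_n -> 'B(H, H)) (N : nat) : 'B(tens T E H, tens T Y H) :=
  \sum_(k < N) \sum_(w : k.-tuple 'I_n) bop_tens T (A w) (bop_word X w).

Definition free_growth (A : seq 'I_n -> 'B(E, Y)) :=
  (limn_esup (fun k => ((opnorm (\sum_(w : k.-tuple 'I_n) adj (A w) \ob A w))
     `^ ((2 * k)%:R^-1))%:E) <= 1)%E.

End free_holomorphic.

(* A free holomorphic function on [B(H)^n]_1 together with its coefficients
   (which it determines when H is infinite dimensional).  The values of
   free_map outside of the ball are irrelevant. *)
Record free_holomorphic (R : realType) (T : tensor_product R) (n : nat)
    (E Y H : hilbertType R) := FreeHolomorphic {
  free_map :> ('I_n -> 'B(H, H)) -> 'B(tens T E H, tens T Y H) ;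
  free_coef : seq 'I_n -> 'B(E, Y) ;
  free_coef_growth : free_growth free_coef ;
  free_mapE : forall X, op_ball X ->
    opcvg (free_series T free_coef X) (free_map X) }.

(* The value of the power series of Theta at operators on a space K. *)
Definition free_eval (R : realType) (T : tensor_product R) (n : nat)
    (E Y H : hilbertType R) (Theta : free_holomorphic T n E Y H)
    (K : hilbertType R) (X : 'I_n -> 'B(K, K)) :
    'B(tens T E K, tens T Y K) :=
  xget 0 [set L : 'B(_, _) | opcvg (free_series T (free_coef Theta) X) L].

(* Main.v *)
Require Import Defs.
From mathcomp Require Import all_boot all_order all_algebra.
From mathcomp Require Import complex.
From mathcomp Require Import all_classical all_reals all_analysis.
From mathcomp Require Import ring lra.

Set Implicit Arguments.
Unset Strict Implicit.
Unset Printing Implicit Defensive.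

Import Order.TTheory GRing.Theory Num.Theory.
Import numFieldNormedType.Exports.

Local Open Scope classical_set_scope.
Local Open Scope ring_scope.
Local Open Scope complex_scope.

(* For 0 <= s < 1 the Poisson kernel K of sR is an isometry and satisfies
   (R_i^* (x) I) K = K (s R_i)^*, so V = I (x) K is an isometric dilation with
   V^* (A (x) R_w (x) I) V = A (x) (s R)_w.  Taking s = r / g and summing the
   series gives Theta(r R) = V^* (Theta(g R) (x) I) V.  Since V V^* <= I,
     Theta(r R)^* Theta(r R) <= V^* (Theta(g R)^* Theta(g R) (x) I) V
       = P_{sR}[Theta(g R)^* Theta(g R)] <= P_{sR}[phi(g)] = phi(r),
   the last inequality because the Poisson transform is positive. *)

(** * Inner product spaces *)

(** Adjoints, tensor products of operators, associators, creation operators, the defect operator,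
    the Poisson kernel and the values of the series are chosen with [xget] by a property, so each
    must be shown to exist before its property can be used. Operators prescribed on a total set come
    from one extension principle, which asks only for a norm bound on linear combinations; for
    isometries this bound is an equality of Gram matrices. The defect operator of sR is explicit,
    because the sum of the R_i R_i^* is a projection. Strictness of s < 1 makes K isometric: the
    part of |h|^2 missed by the first N terms is at most s^(2N) |h|^2. The curve takes its values in
    S because R_i^* R_j = delta_ij reduces every R_v^* R_w to a word, the adjoint of a word, or 0.
    The same relation turns the Gram operator of a homogeneous part of Theta into a multiple of (sum
    of A_w^* A_w) (x) I, whence the norm convergence at rR. *)

Section real_norm.
Context {R : realType}.

(** The norm of a normed module over [R[i]] is a complex number; its real part moves estimates to
    [R], where [lra] and [nra] apply. *)
Definition nrm (V : normedZmodType R[i]) (x : V) : R := complex.Re `|x|.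

Section normed_zmodule.
Context {V : normedZmodType R[i]}.
Implicit Types x y : V.

Lemma nrmE x : `|x| = (nrm x)%:C.
Proof. by rewrite /nrm RRe_real ?normr_real. Qed.

Lemma nrm_ge0 x : 0 <= nrm x.
Proof. by rewrite -lecR -nrmE normr_ge0. Qed.

Lemma nrm0 : nrm (0 : V) = 0.
Proof. by rewrite /nrm normr0. Qed.

Lemma nrm0_eq0 x : nrm x = 0 -> x = 0.
Proof. by move=> x0; apply/normr0_eq0; rewrite nrmE x0. Qed.

Lemma nrmD x y : nrm (x + y) <= nrm x + nrm y.
Proof. by rewrite -lecR rmorphD/= -!nrmE ler_normD. Qed.

Lemma nrmN x : nrm (- x) = nrm x.
Proof. by rewrite /nrm normrN. Qed.

Lemma nrmC x y : nrm (x - y) = nrm (y - x).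
Proof. by rewrite -nrmN opprB. Qed.

Lemma nrm_triangle x y z : nrm (x - z) <= nrm (x - y) + nrm (y - z).
Proof. by rewrite -[x - z](subrKA y) nrmD. Qed.

Lemma nrmB_ge x y : nrm x <= nrm (x - y) + nrm y.
Proof. by rewrite -{1}[x](subrK y) nrmD. Qed.

Lemma nrm_small x : (forall eps : R, 0 < eps -> nrm x < eps) -> x = 0.
Proof.
move=> xe; apply: nrm0_eq0; apply/eqP; rewrite eq_le nrm_ge0 andbT.
by apply/ler_addgt0Pr => eps e0; rewrite add0r ltW// xe.
Qed.

End normed_zmodule.

Lemma nrmM (a b : R[i]) : nrm (a * b) = nrm a * nrm b.
Proof. by apply: complexI; rewrite rmorphM/= -!nrmE normrM. Qed.

Lemma nrm_real (r : R) : nrm r%:C = `|r|.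
Proof. by rewrite /nrm normc_def/= expr0n/= addr0 sqrtr_sqr. Qed.

Lemma conj_real (r : R) : ((r%:C)^*)%R = r%:C.
Proof. by apply/eqP; rewrite eq_complex /= oppr0 !eqxx. Qed.

Lemma Re_le_nrm (a : R[i]) : complex.Re a <= nrm a.
Proof.
rewrite /nrm normc_def/=; apply: (le_trans (ler_norm _)).
by rewrite -sqrtr_sqr ler_wsqrtr// lerDl sqr_ge0.
Qed.

Lemma nrmZ (V : normedModType R[i]) (a : R[i]) (x : V) :
  nrm (a *: x) = nrm a * nrm x.
Proof. by apply: complexI; rewrite rmorphM/= -!nrmE normrZ. Qed.

(** Only a bound from above: the notion serves for majorants of norms and passes to smaller
    sequences without sign conditions. *)
Definition vanishes (b : nat -> R) :=
  forall eps : R, 0 < eps -> exists N, forall k, (N <= k)%N -> b k < eps.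

Lemma vanishes_geometric (C rho : R) : 0 <= rho -> rho < 1 ->
  vanishes (fun k => C * rho ^+ k).
Proof.
move=> r0 r1 eps e0.
have /cvgrPdist_lt/(_ _ e0) : C * rho ^+ k @[k --> \oo] --> (0 : R).
  rewrite -(mulr0 C); apply: cvgMr; apply: cvg_expr.
  by rewrite ger0_norm.
move=> [N _ PN]; exists N => k Nk; have := PN k Nk.
by rewrite sub0r normrN; apply: le_lt_trans; rewrite ler_norm.
Qed.

Lemma vanishesZ (C : R) b : 0 <= C -> vanishes b -> vanishes (fun k => C * b k).
Proof.
move=> C0 b0 eps e0; have C1 : 0 < C + 1 by lra.
have [N bN] := b0 _ (divr_gt0 e0 C1); exists N => k /bN.
rewrite ltr_pdivlMr// => bk; have [b0'|b0'] := leP 0 (b k).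
  by apply: le_lt_trans bk; nra.
by apply: le_lt_trans e0; nra.
Qed.

Lemma vanishesD b c : vanishes b -> vanishes c -> vanishes (fun k => b k + c k).
Proof.
move=> b0 c0 eps e0; have e2 : 0 < eps / 2 by lra.
have [N bN] := b0 _ e2; have [M cM] := c0 _ e2.
by exists (maxn N M) => k; rewrite geq_max => /andP[/bN ? /cM ?]; lra.
Qed.

Lemma vanishes_le b c : (forall k, b k <= c k) -> vanishes c -> vanishes b.
Proof.
move=> bc c0 eps /c0[N cN]; exists N => k /cN; exact: le_lt_trans.
Qed.

Lemma vanishes_harmonic : vanishes (fun k => k.+1%:R^-1).
Proof.
move=> eps e0; exists (Num.truncn (eps^-1)) => k Nk.
rewrite invf_plt ?posrE// (lt_le_trans (truncnS_gt _))// ler_nat.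
exact: leq_trans Nk _.
Qed.

Lemma le_vanishes (a c : R) b : vanishes b -> (forall k, a <= c + b k) -> a <= c.
Proof.
move=> b0 ab; apply/ler_addgt0Pr => eps /b0[N /(_ _ (leqnn N)) bN].
by apply: (le_trans (ab N)); rewrite lerD2l ltW.
Qed.

Lemma nrm_vanishes0 (V : normedZmodType R[i]) (x : V) b :
  vanishes b -> (forall k, nrm x <= b k) -> x = 0.
Proof.
move=> b0 xb; apply: nrm0_eq0; apply/eqP; rewrite eq_le nrm_ge0 andbT.
by apply: (le_vanishes b0) => k; rewrite add0r.
Qed.

Lemma gt0_complexE (a : R[i]) : 0 < a -> exists2 r : R, 0 < r & a = r%:C.
Proof.
move=> a0; have aE : (complex.Re a)%:C = a by rewrite RRe_real// gtr0_real.
by exists (complex.Re a); rewrite // -ltcR aE.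
Qed.

(** Letting l grow in the Cauchy estimate removes [b l], so the rate [b] survives in the limit;
    pointwise limits can then be compared uniformly. *)
Lemma complete_limit (V : completeNormedModType R[i]) (u : nat -> V) b :
  vanishes b -> (forall k l, nrm (u k - u l) <= b k + b l) ->
  exists l, forall k, nrm (u k - l) <= b k.
Proof.
move=> b0 ub; have cu : cauchy (u @ \oo).
  apply/cauchyP => _ /gt0_complexE[e e0 ->].
  have [N bN] := b0 _ (divr_gt0 e0 (ltr0Sn R 1)).
  exists (u N); exists N => // k /= Nk.
  rewrite -ball_normE/= nrmE ltcR.
  apply: (le_lt_trans (ub _ _)).
  by have := bN _ Nk; have := bN _ (leqnn N); rewrite /=; lra.
have /cauchy_cvg/cvg_ex[l /cvgrPdist_lt ul] := cu.
exists l => k; apply/ler_addgt0Pr => eps e0; have e2 : 0 < eps / 2 by lra.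
have e2C : 0 < (eps / 2)%:C :> R[i] by rewrite ltcR.
have [N _ uN] := ul _ e2C; have [M bM] := b0 _ e2.
have := uN (maxn N M) (leq_maxl _ _); rewrite nrmE ltcR nrmC.
have := bM (maxn N M) (leq_maxr _ _).
have := nrm_triangle (u k) (u (maxn N M)) l; have := ub k (maxn N M); lra.
Qed.

Lemma limn_esup_lt (u : nat -> \bar R) (a b : \bar R) :
  (limn_esup u <= a)%E -> (a < b)%E ->
  exists N, forall k, (N <= k)%N -> (u k < b)%E.
Proof.
move=> ua ab; have /ereal_inf_lt[_ [V [N _ NV] <-] Vb] := le_lt_trans ua ab.
exists N => k /NV Vk; apply: le_lt_trans Vb; apply: ereal_sup_ubound.
by exists k.
Qed.

End real_norm.

Section inner_product.
Context {R : realType} {H : hilbertType R}.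
Implicit Types x y z : H.

Lemma hdotDl x y z : hdot (x + y) z = hdot x z + hdot y z.
Proof. by rewrite linearDl. Qed.

Lemma hdotDr x y z : hdot z (x + y) = hdot z x + hdot z y.
Proof. by rewrite linearDr. Qed.

Lemma hdotZl a x y : hdot (a *: x) y = a * hdot x y.
Proof. by rewrite linearZl_LR. Qed.

Lemma hdotZr a x y : hdot x (a *: y) = (a^*)%R * hdot x y.
Proof. by rewrite linearZr_LR. Qed.

Lemma hdotC x y : hdot x y = ((hdot y x)^*)%R.
Proof. by rewrite hermC expr0 mul1r. Qed.

Lemma hdot0l x : hdot 0 x = 0.
Proof. by rewrite linear0l. Qed.

Lemma hdot0r x : hdot x 0 = 0.
Proof. by rewrite linear0r. Qed.

Lemma hdotBl x y z : hdot (x - y) z = hdot x z - hdot y z.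
Proof. by rewrite linearBl. Qed.

Lemma hdotBr x y z : hdot z (x - y) = hdot z x - hdot z y.
Proof. by rewrite linearBr. Qed.

Lemma hdot_suml (I : Type) (r : seq I) (P : pred I) (f : I -> H) y :
  hdot (\sum_(i <- r | P i) f i) y = \sum_(i <- r | P i) hdot (f i) y.
Proof. by rewrite linear_sumlz. Qed.

Lemma hdot_sumr (I : Type) (r : seq I) (P : pred I) (f : I -> H) y :
  hdot y (\sum_(i <- r | P i) f i) = \sum_(i <- r | P i) hdot y (f i).
Proof. by rewrite linear_sumr. Qed.

Lemma hdot_nrm x : hdot x x = (nrm x ^+ 2)%:C.
Proof. by rewrite -hdotE nrmE rmorphXn. Qed.

Lemma nrm_sqr x : nrm x ^+ 2 = complex.Re (hdot x x).
Proof. by rewrite hdot_nrm. Qed.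

Lemma hdot_eq0 x : hdot x x = 0 -> x = 0.
Proof. by move=> /eqP; rewrite -hdotE sqrf_eq0 normr_eq0 => /eqP. Qed.

Lemma hdot_ext x y : (forall z, hdot x z = hdot y z) -> x = y.
Proof.
by move=> xy; apply/eqP; rewrite -subr_eq0; apply/eqP/hdot_eq0;
   rewrite hdotBl xy subrr.
Qed.

Lemma cauchy_schwarz x y : nrm (hdot x y) <= nrm x * nrm y.
Proof.
have [->|y0] := eqVneq y 0; first by rewrite hdot0r !nrm0 mulr0.
rewrite -(@ler_pXn2r _ 2) ?nnegrE ?mulr_ge0 ?nrm_ge0// exprMn.
(* Squared norm of the part of x orthogonal to y, scaled by <y, y> to avoid a division. *)
have : 0 <= hdot (hdot y y *: x - hdot x y *: y) (hdot y y *: x - hdot x y *: y).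
  by rewrite dnorm_ge0.
rewrite !(hdotBl, hdotBr, hdotZl, hdotZr) -!hdotC.
set X := hdot x x; set N := hdot y y; set d := hdot x y; set d' := hdot y x.
rewrite (_ : _ - _ = N * (N * X - d * d')); last by ring.
rewrite pmulr_rge0; last by rewrite lt_neqAle dnorm_ge0 eq_sym andbT;
  apply: contra y0 => /eqP/hdot_eq0->.
rewrite subr_ge0 /d' hdotC -normCK nrmE -rmorphXn/= /N /X !hdot_nrm -rmorphM lecR.
by rewrite mulrC.
Qed.

Lemma nrm_sqrD x y :
  nrm (x + y) ^+ 2 = nrm x ^+ 2 + nrm y ^+ 2 + 2 * complex.Re (hdot x y).
Proof.
rewrite !nrm_sqr hdotDl !hdotDr (hdotC y x) !raddfD/=.
have -> : complex.Re ((hdot x y)^*)%R = complex.Re (hdot x y) by case: (hdot x y).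
ring.
Qed.

Lemma nrm_sqrD_orth x y : hdot x y = 0 ->
  nrm (x + y) ^+ 2 = nrm x ^+ 2 + nrm y ^+ 2.
Proof. by move=> xy; rewrite nrm_sqrD xy/= mulr0 addr0. Qed.

Lemma parallelogram x y :
  nrm (x - y) ^+ 2 = 2 * nrm x ^+ 2 + 2 * nrm y ^+ 2 - nrm (x + y) ^+ 2.
Proof.
rewrite !nrm_sqrD nrmN -scaleN1r hdotZr rmorphN rmorph1 mulN1r raddfN/=; ring.
Qed.

Lemma nrm_sqr_sum_orth (I : finType) (f : I -> H) :
  (forall i j, i != j -> hdot (f i) (f j) = 0) ->
  nrm (\sum_i f i) ^+ 2 = \sum_i nrm (f i) ^+ 2.
Proof.
move=> fo; apply: complexI; rewrite -hdot_nrm rmorph_sum/= hdot_suml.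
apply: eq_bigr => i _; rewrite hdot_sumr (bigD1 i)//= big1 ?addr0 ?hdot_nrm//.
by move=> j ji; rewrite fo// eq_sym.
Qed.

End inner_product.
(** * Bounded operators *)

Section bounded_operators.
Context {R : realType} {H K : hilbertType R}.
Implicit Types A B : 'B(H, K).

Lemma bop_ext A B : (forall x, A x = B x) -> A = B.
Proof. by move=> AB; apply/val_inj/funext. Qed.

Lemma bopDE A B x : (A + B) x = A x + B x. Proof. by []. Qed.

Lemma bopBE A B x : (A - B) x = A x - B x. Proof. by []. Qed.

Lemma bopZE (a : R[i]) A x : (a *: A) x = a *: A x. Proof. by []. Qed.

Lemma bop0E x : (0 : 'B(H, K)) x = 0. Proof. by []. Qed.

Lemma bop_sumE (I : Type) (r : seq I) (P : pred I) (F : I -> 'B(H, K)) x :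
  (\sum_(i <- r | P i) F i) x = \sum_(i <- r | P i) F i x.
Proof. by elim/big_rec2: _ => // i _ B _ <-. Qed.

Lemma bounded_linearW (f : H -> K) (M : R) : linear f ->
  (forall x, nrm (f x) <= M * nrm x) -> f \in @bounded_linear R H K.
Proof.
move=> fl fM; apply/bounded_linearP; split=> //; exists M => x.
by rewrite !nrmE -rmorphM lecR.
Qed.

Lemma bop_real_bound A : exists2 M : R, 0 <= M &
  forall x, nrm (A x) <= M * nrm x.
Proof.
have [M AM] := bop_bounded A; exists `|M| => // x.
have := AM x; rewrite !nrmE -rmorphM lecR => /le_trans; apply.
by rewrite ler_wpM2r ?nrm_ge0// ler_norm.
Qed.

Let unit_values A := [set complex.Re `|A x| | x in [set x : H | `|x| <= 1]].

Let unit_values_has_sup A : has_sup (unit_values A).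
Proof.
split; first by exists (complex.Re `|A 0|), 0; rewrite //= normr0.
have [M M0 AM] := bop_real_bound A; exists M => _ [x /= + <-].
rewrite nrmE -[1]/(1%:C) lecR => x1.
by apply: (le_trans (AM x)); rewrite ler_piMr.
Qed.

Lemma opnorm_ge0 A : 0 <= opnorm A.
Proof.
apply: (le_trans (nrm_ge0 (A 0))); apply: ub_le_sup.
  by have [] := unit_values_has_sup A.
by exists 0; rewrite //= normr0.
Qed.

Lemma nrm_bop A x : nrm (A x) <= opnorm A * nrm x.
Proof.
have [->|x0] := eqVneq x 0; first by rewrite linear0 !nrm0 mulr0.
have xp : 0 < nrm x.
  by rewrite lt_neqAle nrm_ge0 andbT eq_sym; apply: contra x0 => /eqP/nrm0_eq0->.
rewrite -ler_pdivrMr// mulrC; set y := (nrm x)^-1%:C *: x.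
have -> : (nrm x)^-1 * nrm (A x) = nrm (A y).
  by rewrite /y linearZ nrmZ nrm_real ger0_norm ?invr_ge0 ?nrm_ge0.
apply: ub_le_sup; first by have [] := unit_values_has_sup A.
exists y => //=; rewrite nrmE -[1]/(1%:C) lecR /y nrmZ nrm_real.
by rewrite ger0_norm ?invr_ge0 ?nrm_ge0// mulVf// gt_eqF.
Qed.

Lemma opnorm_le A (M : R) : 0 <= M -> (forall x, nrm (A x) <= M * nrm x) ->
  opnorm A <= M.
Proof.
move=> M0 AM; apply: ge_sup.
  by have [] := unit_values_has_sup A.
move=> _ [x /= + <-]; rewrite nrmE -[1]/(1%:C) lecR => x1.
by apply: (le_trans (AM x)); rewrite ler_piMr.
Qed.

Lemma opnormD A B : opnorm (A + B) <= opnorm A + opnorm B.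
Proof.
apply: opnorm_le => [|x]; first by rewrite addr_ge0 ?opnorm_ge0.
by rewrite mulrDl (le_trans (nrmD _ _))// lerD// nrm_bop.
Qed.

Lemma opnormN A : opnorm (- A) = opnorm A.
Proof.
suff le B : opnorm (- B) <= opnorm B.
  by apply/eqP; rewrite eq_le le -{1}[A]opprK le.
by apply: opnorm_le => [|x]; [exact: opnorm_ge0|rewrite -[(- B) x]/(- (B x)) nrmN nrm_bop].
Qed.

Lemma opnormC A B : opnorm (A - B) = opnorm (B - A).
Proof. by rewrite -opnormN opprB. Qed.

Lemma opnorm0 : opnorm (0 : 'B(H, K)) = 0.
Proof.
apply/eqP; rewrite eq_le opnorm_ge0 andbT; apply: opnorm_le => // x.
by rewrite nrm0 mul0r.
Qed.

Lemma opnorm_triangle A B C : opnorm (A - C) <= opnorm (A - B) + opnorm (B - C).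
Proof. by rewrite -[A - C](subrKA B) opnormD. Qed.

Lemma opnorm0_eq0 A : opnorm A = 0 -> A = 0.
Proof.
move=> A0; apply: bop_ext => x; apply: nrm0_eq0; apply/eqP.
by rewrite eq_le nrm_ge0 andbT; have := nrm_bop A x; rewrite A0 mul0r.
Qed.

Lemma opcvgP (A : nat -> 'B(H, K)) L :
  opcvg A L <-> vanishes (fun k => opnorm (A k - L)).
Proof.
split=> [/cvgrPdist_lt AL eps /AL[N _ AN]|AL].
  exists N => k /AN; rewrite sub0r normrN; apply: le_lt_trans.
  exact: ler_norm.
apply/cvgrPdist_lt => eps /AL[N AN]; exists N => // k /AN.
by rewrite sub0r normrN ger0_norm ?opnorm_ge0.
Qed.

(** The pointwise limits satisfy |A_k x - f x| <= b_k |x|, so convergence is already uniform on the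
    unit ball; linearity and boundedness of f follow by comparison with A_k. *)
Lemma bop_complete (A : nat -> 'B(H, K)) b : vanishes b ->
  (forall k l, opnorm (A k - A l) <= b k + b l) ->
  exists L, forall k, opnorm (A k - L) <= b k.
Proof.
move=> b0 Ab; have b_ge0 k : 0 <= b k.
  by have := Ab k k; rewrite subrr opnorm0; lra.
have lim x : {l | forall k, nrm (A k x - l) <= b k * nrm x}.
  apply: cid; apply: complete_limit => [|k l].
    rewrite (_ : (fun _ => _) = fun k => nrm x * b k).
      by apply: vanishesZ => //; exact: nrm_ge0.
    by apply/funext => k; rewrite mulrC.
  rewrite -bopBE; apply: (le_trans (nrm_bop _ _)).
  by rewrite -mulrDl ler_wpM2r ?nrm_ge0.
pose f x := sval (lim x); have fP x k : nrm (A k x - f x) <= b k * nrm x.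
  exact: (svalP (lim x)).
have fl : linear f.
  move=> a x y; apply/eqP; rewrite -subr_eq0; apply/eqP.
  apply: (@nrm_vanishes0 _ _ _ (fun k =>
    (nrm (a *: x + y) + nrm a * nrm x + nrm y) * b k)).
    by apply: vanishesZ => //; rewrite !addr_ge0 ?mulr_ge0 ?nrm_ge0.
  move=> k; have -> : f (a *: x + y) - (a *: f x + f y) =
      (f (a *: x + y) - A k (a *: x + y)) +
      (a *: (A k x - f x) + (A k y - f y)).
    rewrite (bop_linear (A k)); set X := a *: A k x + A k y.
    rewrite (_ : _ *: _ + _ = X - (a *: f x + f y)) ?subrKA//.
    by rewrite scalerBr addrACA -opprD.
  apply: (le_trans (nrmD _ _)); rewrite -addrA mulrDl lerD//.
    by rewrite nrmC mulrC.
  apply: (le_trans (nrmD _ _)); rewrite mulrDl lerD//; last by rewrite mulrC.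
  by rewrite nrmZ -mulrA ler_wpM2l ?nrm_ge0// mulrC.
have fb : f \in @bounded_linear R H K.
  apply: (@bounded_linearW _ (b 0%N + opnorm (A 0%N))) => // x.
  rewrite mulrDl (le_trans (nrmB_ge _ (A 0%N x)))// lerD ?nrm_bop//.
  by rewrite nrmC.
exists (Bop fb) => k; apply: opnorm_le => // x; exact: fP.
Qed.

Lemma bop_series_cvg (D : nat -> 'B(H, K)) (C rho : R) : 0 <= rho -> rho < 1 ->
  (forall k, opnorm (D k) <= C * rho ^+ k) ->
  exists L, opcvg (fun N => \sum_(k < N) D k) L.
Proof.
move=> r0 r1 DC; have r1' : 0 < 1 - rho by lra.
have C0 : 0 <= C.
  by have := DC 0%N; rewrite expr0 mulr1; apply: le_trans; exact: opnorm_ge0.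
pose b k := C / (1 - rho) * rho ^+ k.
have b_ge0 k : 0 <= b k by rewrite mulr_ge0 ?exprn_ge0 ?divr_ge0// ltW.
(* The increment [C * rho ^+ k] is exactly [b k - b k.+1], so the bounds telescope. *)
have tail k j : opnorm (\sum_(i < k + j) D i - \sum_(i < k) D i) <= b k - b (k + j)%N.
  elim: j => [|j IH]; first by rewrite addn0 !subrr opnorm0.
  rewrite addnS big_ord_recr/= addrAC (le_trans (opnormD _ _))//.
  rewrite (le_trans (lerD IH (DC _)))// -addrA lerD2l /b exprS -lerBrDl.
  rewrite le_eqVlt; apply/orP; left; apply/eqP; field; lra.
have vb : vanishes b by exact: vanishes_geometric.
have [|L LP] := @bop_complete (fun N => \sum_(k < N) D k) b vb.
  move=> k l; wlog kl : k l / (k <= l)%N.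
    move=> W; have [/W//|/ltnW/W] := leqP k l.
    by rewrite opnormC [b l + _]addrC.
  rewrite opnormC -(subnKC kl); apply: (le_trans (tail _ _)).
  by rewrite lerD2l (le_trans (_ : _ <= 0)) ?oppr_le0.
by exists L; apply/opcvgP; apply: vanishes_le vb.
Qed.

Lemma opcvg_unique (A : nat -> 'B(H, K)) L L' : opcvg A L -> opcvg A L' -> L = L'.
Proof.
move=> /opcvgP AL /opcvgP AL'; apply/eqP; rewrite -subr_eq0.
apply/eqP/opnorm0_eq0/eqP; rewrite eq_le opnorm_ge0 andbT.
apply: (le_vanishes (vanishesD AL AL')) => k.
by rewrite add0r [opnorm (A k - L)]opnormC opnorm_triangle.
Qed.

End bounded_operators.

Section composition.
Context {R : realType}.
Implicit Types H K L : hilbertType R.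

Lemma bop_compE H K L (A : 'B(K, L)) (B : 'B(H, K)) x : (A \ob B) x = A (B x).
Proof. by []. Qed.

Lemma bop_idE H (x : H) : bop_id H x = x.
Proof. by []. Qed.

Lemma bop_comp1l H K (A : 'B(H, K)) : bop_id K \ob A = A.
Proof. exact: bop_ext. Qed.

Lemma bop_comp1r H K (A : 'B(H, K)) : A \ob bop_id H = A.
Proof. exact: bop_ext. Qed.

Lemma bop_compA H K L L' (A : 'B(L, L')) (B : 'B(K, L)) (C : 'B(H, K)) :
  A \ob B \ob C = A \ob (B \ob C).
Proof. exact: bop_ext. Qed.

Lemma bop_compZl H K L (a : R[i]) (A : 'B(K, L)) (B : 'B(H, K)) :
  (a *: A) \ob B = a *: (A \ob B).
Proof. exact: bop_ext. Qed.

Lemma bop_compZr H K L (a : R[i]) (A : 'B(K, L)) (B : 'B(H, K)) :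
  A \ob (a *: B) = a *: (A \ob B).
Proof. by apply: bop_ext => x; rewrite bop_compE !bopZE linearZ. Qed.

Lemma bop_comp0l H K L (B : 'B(H, K)) : (0 : 'B(K, L)) \ob B = 0.
Proof. exact: bop_ext. Qed.

Lemma bop_comp0r H K L (A : 'B(K, L)) : A \ob (0 : 'B(H, K)) = 0.
Proof. by apply: bop_ext => x; rewrite bop_compE !bop0E linear0. Qed.

Lemma bop_compDr H K L (A : 'B(K, L)) (B B' : 'B(H, K)) :
  A \ob (B + B') = A \ob B + A \ob B'.
Proof. by apply: bop_ext => x; rewrite bop_compE !bopDE linearD. Qed.

Lemma bop_compBl H K L (A A' : 'B(K, L)) (B : 'B(H, K)) :
  (A - A') \ob B = A \ob B - A' \ob B.
Proof. exact: bop_ext. Qed.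

Lemma bop_compBr H K L (A : 'B(K, L)) (B B' : 'B(H, K)) :
  A \ob (B - B') = A \ob B - A \ob B'.
Proof. by apply: bop_ext => x; rewrite bop_compE !bopBE linearB. Qed.

Lemma bop_comp_suml H K L (I : Type) (r : seq I) (P : pred I)
    (F : I -> 'B(K, L)) (B : 'B(H, K)) :
  (\sum_(i <- r | P i) F i) \ob B = \sum_(i <- r | P i) (F i \ob B).
Proof. by apply: bop_ext => x; rewrite bop_compE !bop_sumE. Qed.

Lemma bop_comp_sumr H K L (I : Type) (r : seq I) (P : pred I)
    (F : I -> 'B(H, K)) (A : 'B(K, L)) :
  A \ob (\sum_(i <- r | P i) F i) = \sum_(i <- r | P i) (A \ob F i).
Proof. by apply: bop_ext => x; rewrite bop_compE !bop_sumE linear_sum. Qed.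

Lemma opnorm_comp H K L (A : 'B(K, L)) (B : 'B(H, K)) :
  opnorm (A \ob B) <= opnorm A * opnorm B.
Proof.
apply: opnorm_le => [|x]; first by rewrite mulr_ge0 ?opnorm_ge0.
rewrite bop_compE (le_trans (nrm_bop _ _))// -mulrA ler_wpM2l ?opnorm_ge0//.
exact: nrm_bop.
Qed.

End composition.

(** * Extension of operators from total families *)

Section extension.
Context {R : realType}.

(** The index type is abstract so that one list of coefficients can be evaluated on two families:
    the given vectors and their prescribed images. *)
Definition lincomb (V : lmodType R[i]) (I : Type) (s : I -> V)
  (l : seq (R[i] * I)) : V := \sum_(a <- l) a.1 *: s a.2.

(** Density is that of the linear span of [s], not of its range. *)
Definition dense_family (H : hilbertType R) (I : Type) (s : I -> H) :=
  forall x (eps : R), 0 < eps -> exists l, nrm (x - lincomb s l) < eps.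

Lemma lincombP (V : lmodType R[i]) (I : Type) (s : I -> V) (a : R[i]) l l' :
  lincomb s ([seq (a * b.1, b.2) | b <- l] ++ l') =
  a *: lincomb s l + lincomb s l'.
Proof.
rewrite /lincomb big_cat big_map scaler_sumr; congr (_ + _).
by apply: eq_bigr => b _; rewrite scalerA.
Qed.

Lemma lincomb1 (V : lmodType R[i]) (I : Type) (s : I -> V) i :
  lincomb s [:: (1, i)] = s i.
Proof. by rewrite /lincomb big_seq1 scale1r. Qed.

Lemma bop_lincomb (H K : hilbertType R) (I : Type) (A : 'B(H, K)) (s : I -> H) l :
  A (lincomb s l) = lincomb (A \o s) l.
Proof. by rewrite linear_sum; apply: eq_bigr => a _; rewrite linearZ. Qed.

Lemma dense_family_total (H : hilbertType R) (S : set H) (I : Type) (s : I -> H) :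
  Defs.total S -> S `<=` range s -> dense_family s.
Proof.
move=> St Ss x eps e0; have : closure (hspan S) x by rewrite St.
have eC : 0 < eps%:C :> R[i] by rewrite ltcR.
move=> /(_ _ (nbhsx_ballx x _ eC))[v [[m [c [t [tS ->]]]]]].
rewrite -ball_normE/= nrmE ltcR => xv.
have /choice[j jP] i : exists j, s j = t i.
  by have [j _ <-] := Ss _ (tS i); exists j.
exists [seq (c i, j i) | i <- enum 'I_m].
rewrite /lincomb big_map big_enum/= (eq_bigr (fun i => c i *: t i))// => i _.
by rewrite jP.
Qed.

Section dense.
Context {H K : hilbertType R} {I : Type} {s : I -> H} (sd : dense_family s).

Lemma bop_dense_ext (A B : 'B(H, K)) : (forall i, A (s i) = B (s i)) -> A = B.
Proof.
move=> AB; apply/eqP; rewrite -subr_eq0; apply/eqP/bop_ext => x.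
apply: nrm_small => eps e0.
have M1 : 0 < opnorm (A - B) + 1 by have := opnorm_ge0 (A - B); lra.
have [l xl] := sd x (divr_gt0 e0 M1).
have -> : (A - B) x = (A - B) (x - lincomb s l).
  rewrite linearB [X in _ = _ - X]bop_lincomb /lincomb big1 ?subr0// => a _.
  by rewrite -[(_ \o _) _]/(A (s a.2) - B (s a.2)) AB subrr scaler0.
apply: (le_lt_trans (nrm_bop _ _)); move: xl; rewrite ltr_pdivlMr//.
by apply: le_lt_trans; rewrite mulrDr mulr1 mulrC lerDl nrm_ge0.
Qed.

Lemma hdot_dense_ext (x y : H) :
  (forall i, hdot x (s i) = hdot y (s i)) -> x = y.
Proof.
move=> xy; apply/eqP; rewrite -subr_eq0; apply/eqP.
have {xy}: forall i, hdot (x - y) (s i) = 0 by move=> i; rewrite hdotBl xy subrr.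
move: (x - y) => z zs.
apply: nrm0_eq0; apply/eqP; apply: contraT => z0.
have zp : 0 < nrm z by rewrite lt_neqAle nrm_ge0 eq_sym z0.
(* Approximation within |z| itself suffices: |z|^2 = <z, z - v> <= |z| |z - v| < |z|^2. *)
have [l zl] := sd z zp.
have : hdot z z = hdot z (z - lincomb s l).
  rewrite hdotBr /lincomb hdot_sumr big1 ?subr0// => a _.
  by rewrite hdotZr zs mulr0.
move=> /(congr1 (@complex.Re R)); rewrite -nrm_sqr => zz.
have := le_trans (Re_le_nrm (hdot z (z - lincomb s l))) (cauchy_schwarz _ _).
rewrite -zz expr2 ler_pM2l//; lra.
Qed.

(** The norm bound makes the assignment well defined whatever linear relations hold among the [s i]:
    a vanishing combination of them has a vanishing image. *)
Lemma bop_extend (t : I -> K) (M : R) : 0 <= M ->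
  (forall l, nrm (lincomb t l) <= M * nrm (lincomb s l)) ->
  exists U : 'B(H, K), (forall i, U (s i) = t i) /\ opnorm U <= M.
Proof.
(* [G] is the closure of the set of pairs of corresponding combinations; it is shown to be a bounded
   linear relation before values are chosen. *)
move=> M0 tM; pose G x y := forall eps : R, 0 < eps -> exists l,
  nrm (x - lincomb s l) < eps /\ nrm (y - lincomb t l) < eps.
have G_lin a x y x' y' : G x y -> G x' y' -> G (a *: x + x') (a *: y + y').
  move=> Gxy Gxy' eps e0; have a0 := nrm_ge0 a.
  have a1 : 0 < nrm a + 1 by lra.
  have d0 := divr_gt0 e0 a1; have dE : nrm a * (eps / (nrm a + 1)) + eps / (nrm a + 1) = eps.
    by field; lra.
  have [l [xl yl]] := Gxy _ d0; have [l' [xl' yl']] := Gxy' _ d0.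
  exists ([seq (a * b.1, b.2) | b <- l] ++ l'); rewrite !lincombP.
  have W (V : hilbertType R) (u v u' v' : V) :
      nrm (u - v) < eps / (nrm a + 1) -> nrm (u' - v') < eps / (nrm a + 1) ->
      nrm (a *: u + u' - (a *: v + v')) < eps.
    move=> uv uv'; rewrite opprD addrACA -scalerBr.
    apply: (le_lt_trans (nrmD _ _)); rewrite nrmZ -dE ler_ltD//.
    by rewrite ler_wpM2l// ltW.
  by split; exact: W.
have G_bound x y : G x y -> nrm y <= M * nrm x.
  move=> Gxy; apply/ler_addgt0Pr => eps e0; have M1 : 0 < M + 1 by lra.
  have d0 := divr_gt0 e0 M1; have [l [xl yl]] := Gxy _ d0.
  have dE : M * (eps / (M + 1)) + eps / (M + 1) = eps by field; lra.
  have h1 := nrmB_ge y (lincomb t l).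
  have h2 := nrmB_ge (lincomb s l) x.
  have := tM l; rewrite nrmC in h2; nra.
(* Combinations within 1/(k+1) of x have Cauchy images because of the bound [M]. *)
have G_ex x : exists y, G x y.
  have /choice[v vP] k : exists l, nrm (x - lincomb s l) < k.+1%:R^-1.
    by apply: sd; rewrite invr_gt0.
  have vb : vanishes (fun k => M * (k.+1%:R^-1 : R)).
    by apply: vanishesZ => //; exact: vanishes_harmonic.
  have [|y yP] := @complete_limit _ K (fun k => lincomb t (v k)) _ vb.
    move=> k j; have := tM ([seq (-1 * b.1, b.2) | b <- v j] ++ v k).
    rewrite !lincombP !scaleN1r addrC => /le_trans; apply.
    rewrite -mulrDr ler_wpM2l// addrC.
    apply: (le_trans (nrm_triangle _ x _)).
    by rewrite lerD// ltW// nrmC.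
  exists y => eps e0; have [N1 N1P] := vanishes_harmonic e0.
  have [N2 N2P] := vb _ e0; exists (v (maxn N1 N2)); split.
    by apply: (lt_trans (vP _)); apply: N1P; exact: leq_maxl.
  by rewrite nrmC; apply: (le_lt_trans (yP _)); apply: N2P; exact: leq_maxr.
have G_uniq x y y' : G x y -> G x y' -> y = y'.
  move=> Gy Gy'; have /G_bound := G_lin (-1) _ _ _ _ Gy Gy'.
  rewrite !scaleN1r addNr nrm0 mulr0 => yy'.
  apply/esym/eqP; rewrite -subr_eq0; apply/eqP/nrm0_eq0/eqP.
  by rewrite eq_le nrm_ge0 andbT addrC.
have [f fG] := choice G_ex.
have fl : linear f by move=> a x y; apply: G_uniq (fG _) _; exact: G_lin.
have fM x : nrm (f x) <= M * nrm x by exact: G_bound.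
exists (Bop (bounded_linearW fl fM)); split; last exact: opnorm_le.
move=> i /=; apply: G_uniq (fG _) _ => eps e0; exists [:: (1, i)].
by rewrite !lincomb1 !subrr !nrm0.
Qed.

End dense.

Lemma nrm_lincomb_gram (H K : hilbertType R) (I : Type) (s : I -> H) (t : I -> K) :
  (forall i j, hdot (t i) (t j) = hdot (s i) (s j)) ->
  forall l, nrm (lincomb t l) = nrm (lincomb s l).
Proof.
move=> ts l; apply/eqP; rewrite -(@eqrXn2 _ 2) ?nrm_ge0//; apply/eqP.
rewrite !nrm_sqr /lincomb !hdot_suml; congr (complex.Re _).
apply: eq_bigr => a _; rewrite !hdot_sumr; apply: eq_bigr => b _.
by rewrite !(hdotZl, hdotZr) ts.
Qed.

Lemma bop_extend_gram (H K : hilbertType R) (I : Type) (s : I -> H) (t : I -> K) :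
  dense_family s -> (forall i j, hdot (t i) (t j) = hdot (s i) (s j)) ->
  exists U : 'B(H, K), forall i, U (s i) = t i.
Proof.
move=> sd ts; have [|U [Us _]] := bop_extend sd (@ler01 R) (t := t).
  by move=> l; rewrite mul1r (nrm_lincomb_gram ts).
by exists U.
Qed.

(** The form <A x, x> is continuous in x and the nonnegative reals are closed. As the order of
    [R[i]] also asserts reality, real and imaginary parts pass to the limit separately. *)
Lemma dense_le0 (H : hilbertType R) (I : Type) (s : I -> H) (A : 'B(H, H)) :
  dense_family s ->
  (forall l, 0 <= hdot (A (lincomb s l)) (lincomb s l)) -> bop_le 0 A.
Proof.
move=> sd As x; rewrite bop0E hdot0l.
have approx (eps : R) : 0 < eps ->
    exists2 b : R[i], 0 <= b & nrm (hdot (A x) x - b) < eps.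
  move=> e0; have x0 := nrm_ge0 x; have A0 := opnorm_ge0 A.
  (* The form changes by at most d |A| (2 |x| + 1): the cap 1 gives |v| <= |x| + 1, and the added 1
     keeps the denominator positive. *)
  pose d := Num.min 1 (eps / (opnorm A * (2 * nrm x + 1) + 1)).
  have C0 : 0 < opnorm A * (2 * nrm x + 1) + 1.
    by rewrite ltr_wpDl ?mulr_ge0 ?addr_ge0 ?mulr_ge0.
  have d0 : 0 < d by rewrite lt_min ltr01 divr_gt0.
  have [l] := sd x d d0; set v := lincomb s l => xv.
  exists (hdot (A v) v); first exact: As.
  have -> : hdot (A x) x - hdot (A v) v = hdot (A x) (x - v) + hdot (A (x - v)) v.
    by rewrite hdotBr linearB hdotBl; ring.
  have d1 : d <= 1 by rewrite ge_min lexx.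
  have d2 : d * (opnorm A * (2 * nrm x + 1) + 1) <= eps.
    by rewrite -ler_pdivlMr// ge_min lexx orbT.
  have vx : nrm v <= nrm x + 1.
    by have := nrmB_ge v x; rewrite nrmC; lra.
  have xv0 := nrm_ge0 (x - v).
  have h1 := le_trans (cauchy_schwarz (A x) (x - v))
    (ler_wpM2r xv0 (nrm_bop A x)).
  have h2 := le_trans (cauchy_schwarz (A (x - v)) v)
    (ler_pM (nrm_ge0 _) (nrm_ge0 _) (nrm_bop A (x - v)) vx).
  apply: (le_lt_trans (nrmD _ _)); apply: le_lt_trans (lerD h1 h2) _.
  apply: lt_le_trans d2.
  have -> : opnorm A * nrm x * nrm (x - v) + opnorm A * nrm (x - v) * (nrm x + 1) =
    nrm (x - v) * (opnorm A * (2 * nrm x + 1)) by ring.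
  rewrite [ltRHS]mulrDr mulr1 ltr_pwDr// ler_wpM2r ?(ltW xv)//.
  by rewrite mulr_ge0// addr_ge0 ?mulr_ge0.
set a := hdot (A x) x in approx *.
have Re_ge0 : 0 <= complex.Re a.
  apply/ler_addgt0Pr => eps /approx[b b0]; rewrite nrmC => ab.
  have := Re_le_nrm (b - a); rewrite raddfB/=.
  by move: b0; rewrite lecE/= => /andP[_]; lra.
have Im0 : complex.Im a = 0.
  apply/eqP; rewrite -normr_eq0 eq_le normr_ge0 andbT.
  apply/ler_addgt0Pr => eps /approx[b b0 ab]; rewrite add0r.
  move: b0; rewrite lecE/= => /andP[/eqP b0 _].
  (* Multiplication by i and -i turns the imaginary part into a real part, which the norm bounds. *)
  have := Re_le_nrm ('i * (a - b)); have := Re_le_nrm (- 'i * (a - b)).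
  have -> : nrm ('i * (a - b)) = nrm (a - b).
    by rewrite nrmM /nrm normCi mul1r.
  have -> : nrm (- 'i * (a - b)) = nrm (a - b).
    by rewrite mulNr nrmN nrmM {1}/nrm normCi mul1r.
  rewrite ler_norml; case: (a) b0 ab => ra ia; case: (b) => rb ib /= -> ab; lra.
by rewrite lecE/= Im0 eqxx.
Qed.

End extension.

(** * Riesz representation, adjoints and polarisation *)

Section riesz.
Context {R : realType} {H : hilbertType R}.

(* The representing vector minimises |u|^2 - 2 Re (f u), and minimising
   sequences are Cauchy by the parallelogram identity. *)
Lemma riesz (f : H -> R[i]) (M : R) : scalar f -> 0 <= M ->
  (forall x, nrm (f x) <= M * nrm x) -> exists z, forall x, f x = hdot x z.
Proof.
move=> fl M0 fM.
have fD x y : f (x + y) = f x + f y by rewrite -[x]scale1r fl mul1r scale1r.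
have f0 : f 0 = 0 by apply: (addrI (f 0)); rewrite -fD !addr0.
have fZ a x : f (a *: x) = a * f x by rewrite -[a *: x]addr0 fl f0 addr0.
pose J u := nrm u ^+ 2 - 2 * complex.Re (f u).
have J_ge u : - M ^+ 2 <= J u.
  have := le_trans (Re_le_nrm (f u)) (fM u); rewrite /J.
  have := sqr_ge0 (nrm u - M); nra.
have J_inf : has_inf (range J).
  by split; [exists (J 0), 0 | exists (- M ^+ 2) => _ [u _ <-]; exact: J_ge].
set m := inf (range J).
have Jm u : m <= J u.
  by apply: ge_inf; [have [] := J_inf | exists u].
pose d k : R := k.+1%:R^-1.
have dp k : 0 < d k by rewrite invr_gt0.
have /choice[u uP] k : exists u, J u < m + d k ^+ 2.
  have [_ [v _ <-] Jv] := inf_adherent (exprn_gt0 2 (dp k)) J_inf.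
  by exists v.
(* Since [J] is at least m at the midpoint of v and w, near-minimisers are close to each other. *)
have half v w : nrm (v - w) ^+ 2 <= 2 * (J v - m) + 2 * (J w - m).
  have := Jm ((2^-1)%:C *: (v + w)); rewrite parallelogram /J nrmZ nrm_real fZ fD.
  have -> : complex.Re ((2^-1)%:C * (f v + f w)) =
      2^-1 * (complex.Re (f v) + complex.Re (f w)).
    by case: (f v) => ? ?; case: (f w) => ? ?; rewrite /= mul0r subr0.
  rewrite ger0_norm ?invr_ge0// exprMn; lra.
have vd : vanishes d by exact: vanishes_harmonic.
have v2d : vanishes (fun k => 2 * d k) by exact: vanishesZ.
have [|z zP] := complete_limit v2d (u := u).
  move=> k l; rewrite -(@ler_pXn2r _ 2) ?nnegrE ?nrm_ge0//; last first.
    by rewrite addr_ge0// mulr_ge0// ltW.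
  have := half (u k) (u l); have := uP k; have := uP l.
  have := mulr_gt0 (dp k) (dp l); nra.
have Re_eq h : complex.Re (hdot h z - f h) = 0.
  apply/eqP; rewrite -normr_eq0 eq_le normr_ge0 andbT.
  have C0 : 0 <= (1 + nrm h ^+ 2) / 2 + nrm h * 2.
    by rewrite addr_ge0 ?mulr_ge0 ?addr_ge0 ?sqr_ge0 ?nrm_ge0.
  apply: (le_vanishes (vanishesZ C0 vd)) => k; rewrite add0r.
  set c := complex.Re (hdot h (u k) - f h).
  (* First variation at a near-minimiser: [J] is at least m at u_k + t h and below m + d_k^2 at u_k;
     taking t = d_k and t = -d_k then bounds |c| by a multiple of d_k. *)
  have step t : - d k ^+ 2 <= 2 * t * c + t ^+ 2 * nrm h ^+ 2.
    have := Jm (u k + t%:C *: h); have := uP k.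
    rewrite /J nrm_sqrD fD fZ hdotZr nrmZ nrm_real exprMn real_normK ?num_real//.
    rewrite /c (hdotC h (u k)).
    case: (hdot (u k) h) => a b; case: (f (u k)) => a1 b1; case: (f h) => a2 b2 /=.
    lra.
  have ck : `|c| <= d k * ((1 + nrm h ^+ 2) / 2).
    have := dp k; have := step (d k); have := step (- d k).
    rewrite sqrrN => s1 s2 dk; rewrite -(ler_pM2l dk).
    by have [c0|c0] := ger0P c; lra.
  have -> : hdot h z - f h = (hdot h (u k) - f h) + hdot h (z - u k).
    by rewrite hdotBr; ring.
  rewrite raddfD/= -/c (le_trans (ler_normD _ _))// mulrC mulrDr lerD//.
  have := zP k; rewrite nrmC => /(ler_wpM2l (nrm_ge0 h)).
  move=> /(le_trans (cauchy_schwarz h (z - u k))) zu.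
  have h1 := Re_le_nrm (hdot h (z - u k)).
  have h2 := Re_le_nrm (- hdot h (z - u k)); rewrite nrmN raddfN/= in h2.
  by rewrite ler_norml; lra.
exists z => h; apply/eqP; rewrite eq_sym -subr_eq0.
have := Re_eq h; have := Re_eq ('i *: h); rewrite hdotZl fZ -mulrBr.
case: (hdot h z - f h) => a b /= + ->.
by rewrite mul0r sub0r mul1r => /eqP; rewrite oppr_eq0 => /eqP->.
Qed.

End riesz.

Section adjoint.
Context {R : realType}.
Implicit Types H K L : hilbertType R.

(** Riesz applied to x -> <A x, z> gives the value at z, uniqueness of the vector gives linearity,
    and |f u|^2 = <A (f u), u> gives the bound. Hence the choice in [adj] always has a candidate. *)
Lemma adjP H K (A : 'B(H, K)) x y : hdot (A x) y = hdot x (adj A y).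
Proof.
suff [B BP] : exists B : 'B(K, H), forall x y, hdot (A x) y = hdot x (B y).
  by rewrite /adj; move: x y; case: xgetP => [B' _|/(_ B)].
have /choice[f fP] z : exists z', forall x, hdot (A x) z = hdot x z'.
  apply: (@riesz _ _ _ (opnorm A * nrm z)).
  - by move=> a u v; rewrite linearP hdotDl hdotZl.
  - by rewrite mulr_ge0 ?opnorm_ge0 ?nrm_ge0.
  - move=> u; rewrite mulrAC (le_trans (cauchy_schwarz _ _))//.
    by rewrite ler_wpM2r ?nrm_ge0// nrm_bop.
have fl : linear f.
  move=> a u v; apply: hdot_ext => w; rewrite hdotC [RHS]hdotC -fP.
  by rewrite !(hdotDr, hdotZr) !fP.
have fb u : nrm (f u) <= opnorm A * nrm u.
  have [->|f0] := eqVneq (nrm (f u)) 0.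
    by rewrite mulr_ge0 ?opnorm_ge0 ?nrm_ge0.
  have fp : 0 < nrm (f u) by rewrite lt_neqAle nrm_ge0 eq_sym f0.
  rewrite -(ler_pM2l fp) -expr2 nrm_sqr -fP.
  rewrite (le_trans (Re_le_nrm _))// (le_trans (cauchy_schwarz _ _))//.
  by rewrite mulrCA mulrA ler_wpM2r ?nrm_ge0// nrm_bop.
by exists (Bop (bounded_linearW fl fb)).
Qed.

Lemma adjPr H K (A : 'B(H, K)) x y : hdot x (A y) = hdot (adj A x) y.
Proof. by rewrite hdotC adjP -hdotC. Qed.

Lemma adj_unique H K (A : 'B(H, K)) (B : 'B(K, H)) :
  (forall x y, hdot (A x) y = hdot x (B y)) -> adj A = B.
Proof.
move=> AB; apply: bop_ext => y; apply: hdot_ext => z.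
by rewrite hdotC [RHS]hdotC -adjP AB.
Qed.

Lemma adjK H K (A : 'B(H, K)) : adj (adj A) = A.
Proof. by apply: adj_unique => x y; rewrite adjPr. Qed.

Lemma adj_comp H K L (A : 'B(K, L)) (B : 'B(H, K)) :
  adj (A \ob B) = adj B \ob adj A.
Proof. by apply: adj_unique => x y; rewrite !bop_compE !adjP. Qed.

Lemma adj_id H : adj (bop_id H) = bop_id H.
Proof. exact: adj_unique. Qed.

Lemma adj0 H K : adj (0 : 'B(H, K)) = 0.
Proof. by apply: adj_unique => x y; rewrite !bop0E hdot0l hdot0r. Qed.

Lemma adjD H K (A B : 'B(H, K)) : adj (A + B) = adj A + adj B.
Proof. by apply: adj_unique => x y; rewrite !bopDE hdotDl hdotDr !adjP. Qed.

Lemma adjB H K (A B : 'B(H, K)) : adj (A - B) = adj A - adj B.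
Proof. by apply: adj_unique => x y; rewrite !bopBE hdotBl hdotBr !adjP. Qed.

Lemma adjZ H K (a : R[i]) (A : 'B(H, K)) : adj (a *: A) = (a^*)%R *: adj A.
Proof.
by apply: adj_unique => x y; rewrite !bopZE hdotZl hdotZr conjCK adjP.
Qed.

Lemma adj_sum H K (I : Type) (r : seq I) (P : pred I) (F : I -> 'B(H, K)) :
  adj (\sum_(i <- r | P i) F i) = \sum_(i <- r | P i) adj (F i).
Proof.
by elim/big_rec2: _ => [|i A B _ <-]; rewrite ?adj0 ?adjD.
Qed.

Lemma nrm_adj_comp H K (A : 'B(H, K)) x :
  hdot ((adj A \ob A) x) x = (nrm (A x) ^+ 2)%:C.
Proof. by rewrite bop_compE -adjPr hdot_nrm. Qed.

Lemma opnorm_adj H K (A : 'B(H, K)) : opnorm (adj A) <= opnorm A.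
Proof.
apply: opnorm_le => [|x]; first exact: opnorm_ge0.
have [->|f0] := eqVneq (nrm (adj A x)) 0.
  by rewrite mulr_ge0 ?opnorm_ge0 ?nrm_ge0.
have fp : 0 < nrm (adj A x) by rewrite lt_neqAle nrm_ge0 eq_sym f0.
rewrite -(ler_pM2l fp) -expr2 nrm_sqr -adjP.
rewrite (le_trans (Re_le_nrm _))// (le_trans (cauchy_schwarz _ _))//.
by rewrite mulrCA mulrA ler_wpM2r ?nrm_ge0// nrm_bop.
Qed.

(** Half of the C*-identity, from |A x|^2 = <A^* A x, x>; it bounds an operator whose A^* A is
    explicit, such as a homogeneous part of the series. *)
Lemma opnorm_sqr H K (A : 'B(H, K)) : opnorm A ^+ 2 <= opnorm (adj A \ob A).
Proof.
have B0 := opnorm_ge0 (adj A \ob A).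
rewrite -[leRHS]sqr_sqrtr// ler_pXn2r ?nnegrE ?opnorm_ge0 ?sqrtr_ge0//.
apply: opnorm_le => [|x]; first exact: sqrtr_ge0.
rewrite -(@ler_pXn2r _ 2) ?nnegrE ?mulr_ge0 ?sqrtr_ge0 ?nrm_ge0// exprMn.
rewrite sqr_sqrtr// nrm_sqr adjPr -bop_compE.
rewrite (le_trans (Re_le_nrm _))// (le_trans (cauchy_schwarz _ _))//.
by rewrite expr2 mulrA ler_wpM2r ?nrm_ge0 ?nrm_bop.
Qed.

(** Polarisation with x + y and i x + y: over the complex numbers the quadratic form determines the
    operator. *)
Lemma bop_form_eq0 H (A : 'B(H, H)) : (forall x, hdot (A x) x = 0) -> A = 0.
Proof.
move=> A0; apply: bop_ext => x; apply: hdot_ext => y; rewrite hdot0l.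
have s1 : hdot (A x) y + hdot (A y) x = 0.
  by have := A0 (x + y); rewrite (linearD A) hdotDl !hdotDr !A0 add0r addr0.
have s2 : 'i * (hdot (A x) y - hdot (A y) x) = 0.
  have := A0 ('i *: x + y); rewrite (bop_linear A) hdotDl !hdotDr !hdotZl !hdotZr !A0.
  by rewrite mulr0 mulr0 add0r addr0 => <-; rewrite conjCi; ring.
move/eqP: s2; rewrite mulf_eq0 (negPf (neq0Ci _))/= subr_eq0 => /eqP s2.
move/eqP: s1; rewrite -s2 -mulr2n mulrn_eq0/= => /eqP; exact.
Qed.

Lemma isometry_adjK H K (A : 'B(H, K)) :
  (forall x, nrm (A x) = nrm x) -> adj A \ob A = bop_id H.
Proof.
move=> Ai; apply/eqP; rewrite -subr_eq0; apply/eqP/bop_form_eq0 => x.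
by rewrite bopBE hdotBl nrm_adj_comp Ai hdot_nrm subrr.
Qed.

Lemma positive_selfadjoint H (A : 'B(H, H)) : bop_le 0 A -> adj A = A.
Proof.
move=> A0; apply/eqP; rewrite -subr_eq0; apply/eqP/bop_form_eq0 => x.
rewrite bopBE hdotBl -adjPr hdotC; have := A0 x; rewrite bop0E hdot0l => Ax.
by rewrite (CrealP _) ?subrr// ger0_real.
Qed.

End adjoint.

(** * Norm limits of operators *)

Section limits.
Context {R : realType}.
Implicit Types H K L : hilbertType R.

Lemma cvg_vanishes (V : normedModType R[i]) (u : nat -> V) l :
  u @ \oo --> l <-> vanishes (fun k => nrm (u k - l)).
Proof.
split=> [/cvgrPdist_lt ul eps e0|ul].
  have eC : 0 < eps%:C :> R[i] by rewrite ltcR.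
  by have [N _ uN] := ul _ eC; exists N => k /uN; rewrite /= nrmE ltcR nrmC.
apply/cvgrPdist_lt => _ /gt0_complexE[eps e0 ->].
by have [N uN] := ul _ e0; exists N => // k /uN; rewrite /= nrmE ltcR nrmC.
Qed.

Lemma opcvg_compl H K L (A : nat -> 'B(H, K)) M (B : 'B(K, L)) :
  opcvg A M -> opcvg (fun k => B \ob A k) (B \ob M).
Proof.
move=> /opcvgP AM; apply/opcvgP.
apply: vanishes_le (vanishesZ (opnorm_ge0 B) AM) => k.
by rewrite -bop_compBr opnorm_comp.
Qed.

Lemma opcvg_compr H K L (A : nat -> 'B(K, L)) M (B : 'B(H, K)) :
  opcvg A M -> opcvg (fun k => A k \ob B) (M \ob B).
Proof.
move=> /opcvgP AM; apply/opcvgP.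
apply: vanishes_le (vanishesZ (opnorm_ge0 B) AM) => k.
by rewrite -bop_compBl mulrC opnorm_comp.
Qed.

Lemma opcvgS H K (A : nat -> 'B(H, K)) M :
  opcvg A M -> opcvg (fun k => A k.+1) M.
Proof.
move=> /opcvgP AM; apply/opcvgP => eps /AM[N AN].
by exists N => k Nk; apply: AN; exact: leqW.
Qed.

Lemma opcvg_app H K (A : nat -> 'B(H, K)) M x :
  opcvg A M -> vanishes (fun k => nrm (A k x - M x)).
Proof.
move=> /opcvgP AM; apply: vanishes_le (vanishesZ (nrm_ge0 x) AM) => k.
by rewrite mulrC -bopBE nrm_bop.
Qed.

(** With D = A_k - M the difference is D^* A_k + M^* D, of norm at most |D| (2 |M| + 1) as soon as
    |D| < 1. *)
Lemma opcvg_gram H K (A : nat -> 'B(H, K)) M :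
  opcvg A M -> opcvg (fun k => adj (A k) \ob A k) (adj M \ob M).
Proof.
move=> AM; have /opcvgP AM0 := AM; apply/opcvgP => eps e0.
have L0 := opnorm_ge0 M; have M1 : 0 < 2 * opnorm M + 1 by lra.
have d0 : 0 < Num.min 1 (eps / (2 * opnorm M + 1)).
  by rewrite lt_min ltr01 divr_gt0.
have [N AN] := AM0 _ d0; exists N => k /AN; set D := A k - M => Dd.
have D1 : opnorm D < 1 by apply: lt_le_trans Dd _; rewrite ge_min lexx.
have De : opnorm D * (2 * opnorm M + 1) < eps.
  by rewrite -ltr_pdivlMr//; apply: lt_le_trans Dd _; rewrite ge_min lexx orbT.
have -> : adj (A k) \ob A k - adj M \ob M = adj D \ob A k + adj M \ob D.
  by rewrite /D adjB bop_compBl bop_compBr addrA subrK.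
have AkM : opnorm (A k) <= opnorm M + 1.
  rewrite -[A k](subrK M) -/D addrC (le_trans (opnormD _ _))// lerD2l ltW//.
have D0 := opnorm_ge0 D.
have h1 := le_trans (opnorm_comp (adj D) (A k))
  (ler_pM (opnorm_ge0 _) (opnorm_ge0 _) (opnorm_adj D) AkM).
have h2 := le_trans (opnorm_comp (adj M) D)
  (ler_wpM2r D0 (opnorm_adj M)).
have := opnormD (adj D \ob A k) (adj M \ob D); nra.
Qed.

End limits.
(** * Tensor products *)

Section tensorial.
Context {R : realType}.
Implicit Types H K L : hilbertType R.

(** The algebraic properties of [tmul], stated for a bare map so that the factors can be exchanged
    and an estimate in one of them yields the estimate in the other. *)
Definition tensorial H K L (m : H -> K -> L) :=
  [/\ forall y, linear (m^~ y), forall x, linear (m x) &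
      forall x x' y y', hdot (m x y) (m x' y') = hdot x x' * hdot y y'].

Lemma tensorial_flip H K L (m : H -> K -> L) :
  tensorial m -> tensorial (fun y x => m x y).
Proof. by case=> ml mr md; split=> // *; rewrite md mulrC. Qed.

Section linear_maps.
Context {V W : lmodType R[i]} {f : V -> W} (fl : linear f).

Lemma linear_map0 : f 0 = 0.
Proof.
have := fl 1 0 0; rewrite !scale1r addr0 => /eqP.
by rewrite -[X in X == _]addr0 => /eqP/addrI.
Qed.

Lemma linear_mapZ a x : f (a *: x) = a *: f x.
Proof. by rewrite -[a *: x]addr0 fl linear_map0 addr0. Qed.

Lemma linear_mapD x y : f (x + y) = f x + f y.
Proof. by rewrite -{1}[x]scale1r fl scale1r. Qed.

Lemma linear_mapsum (I : Type) (r : seq I) (g : I -> V) :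
  f (\sum_(i <- r) g i) = \sum_(i <- r) f (g i).
Proof.
elim/big_rec2: _ => [|i y x _ <-]; [exact: linear_map0 | exact: linear_mapD].
Qed.

End linear_maps.

(* Gram-Schmidt on the second factors; the first factors are changed in a way
   that commutes with every linear map, which is why m is quantified last. *)
Lemma orthogonalize H K (l : seq (H * K)) :
  exists (n : nat) (x : 'I_n -> H) (f : 'I_n -> K),
  (forall i j, i != j -> hdot (f i) (f j) = 0) /\
  (forall L (m : H -> K -> L), (forall y, linear (m^~ y)) -> (forall x, linear (m x)) ->
     \sum_(p <- l) m p.1 p.2 = \sum_i m (x i) (f i)).
Proof.
elim: l => [|[x0 y0] l [n [x [f [fo IH]]]]].
  exists 0%N, (fun=> 0), (fun=> 0); split=> [[]//|L m _ _].
  by rewrite big_nil big_ord0.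
(* If [f i] is 0 the quotient is 0 by convention, and orthogonality to [f i] is trivial. *)
pose a i := hdot y0 (f i) / hdot (f i) (f i).
pose f0 := y0 - \sum_i a i *: f i.
have f0o j : hdot f0 (f j) = 0.
  rewrite hdotBl hdot_suml (bigD1 j)//= big1 => [|i ij]; last first.
    by rewrite hdotZl fo// mulr0.
  rewrite addr0 hdotZl /a; have [fj0|fj0] := eqVneq (f j) 0.
    by rewrite fj0 !hdot0r mulr0 subr0.
  by rewrite divfK ?subrr//; apply: contra fj0 => /eqP/hdot_eq0->.
(* x0 (x) y0 = x0 (x) f0 + sum of (a_i x0) (x) f_i, so the coefficients move to the first
   factors. *)
exists n.+1, (fun i => if unlift ord0 i is Some j then x j + a j *: x0 else x0),
  (fun i => if unlift ord0 i is Some j then f j else f0); split=> [i j|L m ml mr].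
  have [i'|] := unliftP ord0 i; have [j'|] := unliftP ord0 j.
  - by move=> -> ->; rewrite (inj_eq lift_inj); exact: fo.
  - by rewrite hdotC f0o rmorph0.
  - by rewrite f0o.
  - by move=> -> ->; rewrite eqxx.
rewrite big_cons (IH L m)// big_ord_recl unlift_none.
under [in RHS]eq_bigr => i _ do rewrite liftK.
have -> : m x0 y0 = m x0 f0 + \sum_i m x0 (a i *: f i).
  by rewrite -(linear_mapsum (mr x0)) -(linear_mapD (mr x0)) subrK.
rewrite -addrA -big_split/=; congr (_ + _); apply: eq_bigr => i _.
by rewrite (linear_mapZ (mr x0)) [x i + _]addrC ml.
Qed.

Lemma tensorial_nrm H K L (m : H -> K -> L) x y : tensorial m ->
  nrm (m x y) = nrm x * nrm y.
Proof.
case=> _ _ md; apply/eqP; rewrite -(@eqrXn2 _ 2) ?mulr_ge0 ?nrm_ge0//.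
rewrite exprMn; apply/eqP/complexI.
by rewrite -hdot_nrm md !hdot_nrm [RHS]rmorphM.
Qed.

(** Once the second factors are orthogonal, the squared norms are sums of |A x_i|^2 |f_i|^2 and of
    |x_i|^2 |f_i|^2, compared term by term. One orthogonalisation serves both sides, as it does not
    depend on the map. *)
Lemma tensorial_bound H H' K L L' (m : H -> K -> L) (m' : H' -> K -> L')
    (A : 'B(H, H')) (l : seq (H * K)) : tensorial m -> tensorial m' ->
  nrm (\sum_(p <- l) m' (A p.1) p.2) <= opnorm A * nrm (\sum_(p <- l) m p.1 p.2).
Proof.
move=> mt mt'; have [ml mr md] := mt; have [ml' mr' md'] := mt'.
have [n [x [f [fo fE]]]] := orthogonalize l.
rewrite (fE _ (fun x y => m' (A x) y)) ?(fE _ m)//; last first.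
  by move=> y a u v; rewrite bop_linear ml'.
rewrite -(@ler_pXn2r _ 2) ?nnegrE ?mulr_ge0 ?opnorm_ge0 ?nrm_ge0// exprMn.
rewrite !nrm_sqr_sum_orth; last 2 first.
- by move=> i j ij; rewrite md fo ?mulr0.
- by move=> i j ij; rewrite md' fo ?mulr0.
rewrite mulr_sumr ler_sum// => i _; rewrite !tensorial_nrm// -exprMn.
rewrite ler_pXn2r ?nnegrE ?mulr_ge0 ?opnorm_ge0 ?nrm_ge0// mulrA.
by rewrite ler_wpM2r ?nrm_ge0// nrm_bop.
Qed.

End tensorial.

Section tensor_operators.
Context {R : realType} (T : tensor_product R).
Implicit Types H K L : hilbertType R.

Local Notation "x '*t' y" := (tmul T _ _ x y) (at level 40, left associativity).

Lemma tmul_tensorial H K : tensorial (fun x y => tmul T H K x y).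
Proof.
split=> [y a u v|x a u v|x x' y y']; last exact: hdot_tmul.
- by rewrite linearPl.
- by rewrite linearPr.
Qed.

Lemma tens_dense H K : dense_family (fun p : H * K => p.1 *t p.2).
Proof.
by apply: dense_family_total (total_tmul T H K) _ => _ [p _ <-]; exists p.
Qed.

Lemma lincomb_tmul H K L (m : H -> K -> L) (l : seq (R[i] * (H * K))) :
  (forall y, linear (m^~ y)) ->
  lincomb (fun p => m p.1 p.2) l =
  \sum_(p <- [seq (a.1 *: a.2.1, a.2.2) | a <- l]) m p.1 p.2.
Proof.
move=> ml; rewrite /lincomb big_map; apply: eq_bigr => -[a [x y]] _ /=.
by rewrite (linear_mapZ (ml y)).
Qed.

Lemma tens_ext H K L (A B : 'B(tens T H K, L)) :
  (forall x y, A (x *t y) = B (x *t y)) -> A = B.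
Proof. by move=> AB; apply: (bop_dense_ext (@tens_dense H K)) => -[x y] /=. Qed.

Lemma hdot_tens_ext H K (u v : tens T H K) :
  (forall x y, hdot u (x *t y) = hdot v (x *t y)) -> u = v.
Proof. by move=> uv; apply: (hdot_dense_ext (@tens_dense H K)) => -[x y] /=. Qed.

(** The bound on sums of elementary tensors treats A (x) B as A (x) I after I (x) B: one factor at a
    time, the second through the flipped product. *)
Lemma bop_tensP H K H' K' (A : 'B(H, H')) (B : 'B(K, K')) :
  (forall x y, bop_tens T A B (x *t y) = A x *t B y) /\
  opnorm (bop_tens T A B) <= opnorm A * opnorm B.
Proof.
have [|l|U [UE Ub]] := @bop_extend _ _ _ _ _ (@tens_dense H K)
    (fun p => A p.1 *t B p.2) (opnorm A * opnorm B).
- by rewrite mulr_ge0 ?opnorm_ge0.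
- have [hl hr _] := tmul_tensorial H K.
  have [hl1 hr1 hd1] := tmul_tensorial H' K'.
  rewrite (lincomb_tmul (m := fun x y => A x *t B y)); last first.
    by move=> y a u v; rewrite bop_linear hl1.
  rewrite (lincomb_tmul (m := fun x y => x *t y))//.
  move: (map _ l) => l'; rewrite -mulrA.
  have [hl2 hr2 hd2] := tmul_tensorial H K'.
  have h1 := tensorial_bound A [seq (p.1, B p.2) | p <- l']
    (tmul_tensorial H K') (tmul_tensorial H' K').
  rewrite !big_map/= in h1; apply: (le_trans h1).
  rewrite ler_wpM2l ?opnorm_ge0//.
  have h2 := tensorial_bound B [seq (p.2, p.1) | p <- l']
    (tensorial_flip (tmul_tensorial H K)) (tensorial_flip (tmul_tensorial H K')).
  by rewrite !big_map in h2.
have PU : forall x y, U (x *t y) = A x *t B y by move=> x y; rewrite (UE (x, y)).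
rewrite /bop_tens; case: xgetP => [V _ PV|/(_ U)//].
by split=> //; rewrite (_ : V = U)//; apply: tens_ext => x y; rewrite PU.
Qed.

Lemma bop_tensE H K H' K' (A : 'B(H, H')) (B : 'B(K, K')) x y :
  bop_tens T A B (x *t y) = A x *t B y.
Proof. by have [->] := bop_tensP A B. Qed.

Lemma opnorm_tens H K H' K' (A : 'B(H, H')) (B : 'B(K, K')) :
  opnorm (bop_tens T A B) <= opnorm A * opnorm B.
Proof. by have [] := bop_tensP A B. Qed.

Lemma opnorm_id H : opnorm (bop_id H) <= 1.
Proof. by apply: opnorm_le => // x; rewrite mul1r. Qed.

Lemma opnorm_tens_id H K K' (B : 'B(K, K')) :
  opnorm (bop_tens T B (bop_id H)) <= opnorm B.
Proof.
apply: (le_trans (opnorm_tens _ _)); rewrite ler_piMr ?opnorm_ge0//.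
exact: opnorm_id.
Qed.

Lemma bop_tens_comp H K H' K' H'' K'' (A : 'B(H', H'')) (B : 'B(K', K''))
    (A' : 'B(H, H')) (B' : 'B(K, K')) :
  bop_tens T A B \ob bop_tens T A' B' = bop_tens T (A \ob A') (B \ob B').
Proof. by apply: tens_ext => x y; rewrite bop_compE !bop_tensE. Qed.

Lemma adj_tens H K H' K' (A : 'B(H, H')) (B : 'B(K, K')) :
  adj (bop_tens T A B) = bop_tens T (adj A) (adj B).
Proof.
apply: tens_ext => x y; apply: hdot_tens_ext => x' y'.
by rewrite -adjPr !bop_tensE !hdot_tmul !adjPr.
Qed.

Lemma bop_tens_id H K :
  bop_tens T (bop_id H) (bop_id K) = bop_id (tens T H K).
Proof. by apply: tens_ext => x y; rewrite bop_tensE. Qed.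

Lemma bop_tensDl H K H' K' (A A' : 'B(H, H')) (B : 'B(K, K')) :
  bop_tens T (A + A') B = bop_tens T A B + bop_tens T A' B.
Proof.
by apply: tens_ext => x y; rewrite bopDE !bop_tensE bopDE linearDl.
Qed.

Lemma bop_tensZl H K H' K' (a : R[i]) (A : 'B(H, H')) (B : 'B(K, K')) :
  bop_tens T (a *: A) B = a *: bop_tens T A B.
Proof.
by apply: tens_ext => x y; rewrite bopZE !bop_tensE bopZE linearZl_LR.
Qed.

Lemma bop_tensZr H K H' K' (a : R[i]) (A : 'B(H, H')) (B : 'B(K, K')) :
  bop_tens T A (a *: B) = a *: bop_tens T A B.
Proof.
by apply: tens_ext => x y; rewrite bopZE !bop_tensE bopZE linearZr_LR.
Qed.

Lemma bop_tens0l H K H' K' (B : 'B(K, K')) :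
  bop_tens T (0 : 'B(H, H')) B = 0.
Proof. by rewrite -(scale0r (0 : 'B(H, H'))) bop_tensZl scale0r. Qed.

Lemma bop_tens0r H K H' K' (A : 'B(H, H')) :
  bop_tens T A (0 : 'B(K, K')) = 0.
Proof. by rewrite -(scale0r (0 : 'B(K, K'))) bop_tensZr scale0r. Qed.

Lemma bop_tensBl H K H' K' (A A' : 'B(H, H')) (B : 'B(K, K')) :
  bop_tens T (A - A') B = bop_tens T A B - bop_tens T A' B.
Proof. by rewrite -scaleN1r bop_tensDl bop_tensZl scaleN1r. Qed.

Lemma bop_tens_suml H K H' K' (I : Type) (r : seq I) (P : pred I)
    (F : I -> 'B(H, H')) (B : 'B(K, K')) :
  bop_tens T (\sum_(i <- r | P i) F i) B =
  \sum_(i <- r | P i) bop_tens T (F i) B.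
Proof.
by elim/big_rec2: _ => [|i A A' _ <-]; rewrite ?bop_tens0l ?bop_tensDl.
Qed.

(** On a sum of x_i (x) f_i with orthogonal f_i the form is the sum of <u x_i, x_i> |f_i|^2, which
    avoids a square root of u. Positivity of the Poisson transform rests on this. *)
Lemma bop_tens_ge0 H K (u : 'B(H, H)) :
  bop_le 0 u -> bop_le 0 (bop_tens T u (bop_id K)).
Proof.
move=> u0; apply: (dense_le0 (@tens_dense H K)) => l.
have [hl hr hd] := tmul_tensorial H K.
rewrite bop_lincomb [X in hdot X](_ : _ = lincomb (fun p => u p.1 *t p.2) l);
  last first.
  by rewrite /lincomb; apply: eq_bigr => a _; rewrite /= bop_tensE.
rewrite (lincomb_tmul (m := fun x y => u x *t y)); last first.
  by move=> y a x z; rewrite bop_linear hl.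
rewrite (lincomb_tmul (m := fun x y => x *t y))//.
have [n [x [f [fo fE]]]] := orthogonalize [seq (a.1 *: a.2.1, a.2.2) | a <- l].
rewrite (fE _ (fun x y => u x *t y))//; last first.
  by move=> y a z w; rewrite bop_linear hl.
rewrite (fE _ (fun x y => x *t y))// hdot_suml sumr_ge0// => i _.
rewrite hdot_sumr (bigD1 i)//= big1 => [|j ji]; last first.
  by rewrite hdot_tmul (fo i j) ?mulr0// eq_sym.
rewrite addr0 hdot_tmul mulr_ge0//.
by have := u0 (x i); rewrite bop0E hdot0l.
Qed.

Lemma tmulL_subproof H K (x : H) :
  (fun y => x *t y) \in @bounded_linear R K (tens T H K).
Proof.
have [_ hr _] := tmul_tensorial H K; apply: (bounded_linearW (hr x)) => y.
by rewrite (tensorial_nrm _ _ (tmul_tensorial H K)).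
Qed.

(** Together with [tmulR], this reduces an identity on a threefold product to one on two factors, by
    composition. *)
Definition tmulL H K (x : H) : 'B(K, tens T H K) := Bop (tmulL_subproof K x).

Lemma tmulR_subproof H K (y : K) :
  (fun x => x *t y) \in @bounded_linear R H (tens T H K).
Proof.
have [hl _ _] := tmul_tensorial H K.
apply: (bounded_linearW (M := nrm y) (hl y)) => x.
by rewrite (tensorial_nrm _ _ (tmul_tensorial H K)) mulrC.
Qed.

Definition tmulR H K (y : K) : 'B(H, tens T H K) := Bop (tmulR_subproof H y).

Lemma tmulLE H K (x : H) (y : K) : tmulL K x y = x *t y.
Proof. by []. Qed.

Lemma tmulRE H K (x : H) (y : K) : tmulR H y x = x *t y.
Proof. by []. Qed.

Lemma adj_tmulL_tmulL H K (x x' : H) :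
  adj (tmulL K x') \ob tmulL K x = hdot x x' *: bop_id K.
Proof.
apply: bop_ext => y; apply: hdot_ext => z.
by rewrite bop_compE -adjPr bopZE hdotZl hdot_tmul.
Qed.

(** The tensors x (x) w, with w in K (x) L, are already total, and their images are obtained from w
    by the operator (x (x) -) (x) I. Gram matrices agree because [adj_tmulL_tmulL] is a scalar. *)
Lemma tens_assocP H K L :
  (forall x y z, tens_assoc T H K L (x *t (y *t z)) = x *t y *t z) /\
  adj (tens_assoc T H K L) \ob tens_assoc T H K L = bop_id _.
Proof.
pose t (p : H * tens T K L) := bop_tens T (tmulL K p.1) (bop_id L) p.2.
have tg p q : hdot (t p) (t q) = hdot (p.1 *t p.2) (q.1 *t q.2).
  rewrite adjPr adj_tens -bop_compE bop_tens_comp adj_tmulL_tmulL.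
  by rewrite bop_tensZl adj_id bop_comp1l bop_tens_id bopZE hdotZl hdot_tmul.
have [U UE] := bop_extend_gram (@tens_dense _ _) tg.
have PU x y z : U (x *t (y *t z)) = x *t y *t z.
  by rewrite (UE (x, _)) /t/= bop_tensE tmulLE.
rewrite /tens_assoc; case: xgetP => [V _ PV|/(_ U)//]; split=> //.
(* The defining property speaks of threefold tensors only; for fixed x these determine the operator
   on all w. *)
have -> : V = U.
  apply: tens_ext => x w; rewrite -tmulLE -!bop_compE; congr bop_fun; move: w.
  suff -> : V \ob tmulL _ x = U \ob tmulL _ x by [].
  by apply: tens_ext => y z; rewrite !bop_compE !tmulLE PU.
apply: tens_ext => x w; apply: hdot_tens_ext => x' w'.
by rewrite bop_compE -adjPr (UE (x, w)) (UE (x', w')) tg.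
Qed.

Lemma tens_assocE H K L x y z :
  tens_assoc T H K L (x *t (y *t z)) = x *t y *t z.
Proof. by have [->] := tens_assocP H K L. Qed.

Lemma tens_assocK H K L :
  adj (tens_assoc T H K L) \ob tens_assoc T H K L = bop_id _.
Proof. by have [] := tens_assocP H K L. Qed.

(** An isometry is inverted on its range by its adjoint, and the threefold tensors lie in this
    range; being total, they determine the operator. *)
Lemma tens_assocVE H K L : tens_assocV T H K L = adj (tens_assoc T H K L).
Proof.
have PU x y z : adj (tens_assoc T H K L) (x *t y *t z) = x *t (y *t z).
  by rewrite -tens_assocE -bop_compE tens_assocK.
rewrite /tens_assocV; case: xgetP => [V _ PV|/(_ (adj (tens_assoc T H K L)))//].
apply: tens_ext => w z; rewrite -tmulRE -!bop_compE.
suff -> : V \ob tmulR _ z = adj (tens_assoc T H K L) \ob tmulR _ z by [].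
by apply: tens_ext => x y; rewrite !bop_compE !tmulRE PU.
Qed.

Lemma tens_assoc_nat H K L H' K' L' (A : 'B(H, H')) (B : 'B(K, K'))
    (C : 'B(L, L')) :
  bop_tens T (bop_tens T A B) C \ob tens_assoc T H K L =
  tens_assoc T H' K' L' \ob bop_tens T A (bop_tens T B C).
Proof.
apply: tens_ext => x w; rewrite -tmulLE -!bop_compE.
set U := _ \ob tmulL _ x; set V := _ \ob tmulL _ x.
suff -> : U = V by [].
apply: tens_ext => y z; rewrite !bop_compE !tmulLE.
by rewrite tens_assocE !bop_tensE tens_assocE.
Qed.

End tensor_operators.
(** * The Fock space and the Poisson kernel *)

Section tuple_sums.
Context {V : nmodType} {n : nat}.

Lemma sum_tuple0 (f : seq 'I_n -> V) : \sum_(w : 0.-tuple 'I_n) f w = f [::].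
Proof.
rewrite (bigD1 [tuple])//= big1 ?addr0// => w /negP[].
by apply/eqP; exact: tuple0.
Qed.

Lemma sum_tupleS k (f : seq 'I_n -> V) :
  \sum_(w : k.+1.-tuple 'I_n) f w = \sum_i \sum_(w : k.-tuple 'I_n) f (i :: w).
Proof.
rewrite pair_big/= (reindex (fun p : 'I_n * k.-tuple 'I_n => [tuple of p.1 :: p.2]))//.
exists (fun w => (thead w, [tuple of behead w])) => [[i w] _|w _].
  by congr pair; apply/val_inj.
by rewrite [RHS](tuple_eta w); apply/val_inj.
Qed.

End tuple_sums.

Section fock.
Context {R : realType} {T : tensor_product R} {n : nat} {Hn : hilbertType R}.
Context {e : 'I_n -> Hn} (basis_e : orthonormal_basis e) (F : fock_space T Hn).

Local Notation Rc := (right_creation e F).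
Implicit Types H : hilbertType R.

Definition fock_family (a : option {k & tens_power T Hn k}) : F :=
  if a is Some p then fock_inj F (tag p) (tagged p) else fock_vac F.

Lemma fock_family_dense : dense_family fock_family.
Proof.
apply: dense_family_total (total_fock F) _ => x [->|[k _ [y _ <-]]].
  by exists None.
by exists (Some (Tagged (fun k => tens_power T Hn k) y)).
Qed.

Let created i (a : option {k & tens_power T Hn k}) : F :=
  if a is Some p then fock_inj F (tag p).+1 (tmul T _ _ (tagged p) (e i))
  else fock_inj F 0 (e i).

(** The relation R_j^* R_i = delta_ij on prescribed values, before R_i is known to exist; for i = j
    it is the Gram condition that provides R_i. *)
Let hdot_created i j a b :
  hdot (created i a) (created j b) = (i == j)%:R * hdot (fock_family a) (fock_family b).
Proof.
have eo := basis_e.1; case: a b => [[k x]|] [[l y]|] /=.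
- have [kl|kl] := eqVneq k l; last first.
    rewrite (hdot_fock_inj_neq F x y kl) mulr0.
    exact: (@hdot_fock_inj_neq _ _ _ F k.+1 l.+1 _ _ kl).
  subst l; transitivity (hdot (tmul T _ Hn x (e i)) (tmul T _ Hn y (e j))).
    exact: (@hdot_fock_inj _ _ _ F k.+1).
  by rewrite hdot_tmul hdot_fock_inj eo mulrC.
- rewrite [X in _ * X]hdotC hdot_vac_inj rmorph0 mulr0.
  exact: (@hdot_fock_inj_neq _ _ _ F k.+1 0%N).
- by rewrite hdot_vac_inj mulr0; exact: (@hdot_fock_inj_neq _ _ _ F 0%N l.+1).
- by rewrite hdot_vac mulr1 -eo; exact: (@hdot_fock_inj _ _ _ F 0%N).
Qed.

Lemma right_creation_family i a : Rc i (fock_family a) = created i a.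
Proof.
suff [RV RI] : Rc i (fock_vac F) = fock_inj F 0 (e i) /\
    forall k x, Rc i (fock_inj F k x) = fock_inj F k.+1 (tmul T _ _ x (e i)).
  by case: a => [[k x]|] /=.
have [a' b'|U UE] := @bop_extend_gram _ _ _ _ _ (created i) fock_family_dense.
  by rewrite hdot_created eqxx mul1r.
rewrite /right_creation; case: xgetP => [V _ //|/(_ U)[]].
split=> [|k x]; first exact: (UE None).
exact: (UE (Some (Tagged (fun k => tens_power T Hn k) x))).
Qed.

Lemma right_creation_orth i j :
  adj (Rc i) \ob Rc j = (i == j)%:R *: bop_id F.
Proof.
apply: (bop_dense_ext fock_family_dense) => a.
apply: (hdot_dense_ext fock_family_dense) => b.
rewrite bop_compE -adjPr !right_creation_family hdot_created eq_sym.
by rewrite bopZE hdotZl.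
Qed.

Lemma adj_right_creation_vac i : adj (Rc i) (fock_vac F) = 0.
Proof.
apply: (hdot_dense_ext fock_family_dense) => a.
rewrite -adjPr right_creation_family hdot0l.
case: a => [[k x]|]; first exact: (@hdot_vac_inj _ _ _ F k.+1).
exact: (@hdot_vac_inj _ _ _ F 0%N).
Qed.

(** The last letter sits in the last tensor factor, where right creation acts. With the reversed
    words of the Poisson kernel, prepending i to w amounts to applying R_i. *)
Lemma fock_basis_rcons w i : fock_basis e F (rcons w i) = Rc i (fock_basis e F w).
Proof.
case: w => [|j w]; first by rewrite /= (right_creation_family i None).
rewrite rcons_cons /fock_basis rev_rcons /=.
by rewrite (right_creation_family i (Some (Tagged (fun k => tens_power T Hn k) _))).
Qed.

Lemma right_creation_tens_orth H i j :
  adj (bop_tens T (Rc i) (bop_id H)) \ob bop_tens T (Rc j) (bop_id H) =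
  (i == j)%:R *: bop_id _.
Proof.
by rewrite adj_tens adj_id bop_tens_comp right_creation_orth bop_tensZl
  bop_comp1l bop_tens_id.
Qed.

Lemma adj_right_creation_tens_vac H i :
  adj (bop_tens T (Rc i) (bop_id H)) \ob tmulL T H (fock_vac F) = 0.
Proof.
apply: bop_ext => x; rewrite bop_compE tmulLE adj_tens bop_tensE.
by rewrite adj_right_creation_vac linear0l.
Qed.

Lemma nrm_sqr_sum_creation H (z : 'I_n -> tens T F H) :
  nrm (\sum_i bop_tens T (Rc i) (bop_id H) (z i)) ^+ 2 = \sum_i nrm (z i) ^+ 2.
Proof.
rewrite nrm_sqr_sum_orth => [|i j ij]; last first.
  rewrite adjPr -bop_compE right_creation_tens_orth eq_sym (negPf ij).
  by rewrite scale0r bop0E hdot0l.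
apply: eq_bigr => i _; rewrite !nrm_sqr [in LHS]adjPr -bop_compE.
by rewrite right_creation_tens_orth eqxx scale1r.
Qed.

Lemma nrm_sqr_vac_creation H (x : H) (z : 'I_n -> tens T F H) :
  nrm (tmul T F H (fock_vac F) x + \sum_i bop_tens T (Rc i) (bop_id H) (z i)) ^+ 2 =
  nrm x ^+ 2 + \sum_i nrm (z i) ^+ 2.
Proof.
rewrite nrm_sqrD_orth ?nrm_sqr_sum_creation.
  rewrite (tensorial_nrm _ _ (tmul_tensorial T F H)); congr (_ + _).
  by rewrite exprMn [X in X * _]nrm_sqr hdot_vac mul1r.
rewrite hdot_sumr big1// => i _; rewrite adjPr -tmulLE -bop_compE.
by rewrite -[X in hdot X]/((_ \ob _) _) adj_right_creation_tens_vac bop0E hdot0l.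
Qed.

(** The orthogonal projection onto the complement of the vacuum. *)
Definition vac_corange : 'B(F, F) := \sum_i Rc i \ob adj (Rc i).

Lemma adj_vac_corange : adj vac_corange = vac_corange.
Proof.
by rewrite adj_sum; apply: eq_bigr => i _; rewrite adj_comp adjK.
Qed.

Lemma vac_corange_idem : vac_corange \ob vac_corange = vac_corange.
Proof.
rewrite {1}/vac_corange bop_comp_suml; apply: eq_bigr => i _.
rewrite bop_comp_sumr (bigD1 i)//= big1 ?addr0 => [|j ji].
  by rewrite bop_compA -[adj _ \ob _]bop_compA right_creation_orth eqxx scale1r
    bop_comp1l.
by rewrite bop_compA -[adj _ \ob _]bop_compA right_creation_orth eq_sym (negPf ji)
  scale0r bop_comp0l bop_comp0r.
Qed.

(** The difference of the two sides is |(I - P) h|^2, with P the projection [vac_corange]. *)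
Lemma sum_adj_right_creation h : \sum_i nrm (adj (Rc i) h) ^+ 2 <= nrm h ^+ 2.
Proof.
rewrite -subr_ge0; have := sqr_ge0 (nrm ((bop_id F - vac_corange) h)).
have -> // : nrm ((bop_id F - vac_corange) h) ^+ 2 =
    nrm h ^+ 2 - \sum_i nrm (adj (Rc i) h) ^+ 2.
rewrite nrm_sqr adjPr -bop_compE adjB adj_id adj_vac_corange.
rewrite bop_compBl !bop_compBr !bop_comp1l bop_comp1r vac_corange_idem subrr subr0.
rewrite bopBE hdotBl raddfB/= -nrm_sqr; congr (_ - _).
rewrite bop_sumE hdot_suml raddf_sum/=; apply: eq_bigr => i _.
by rewrite adjP -nrm_sqr.
Qed.

Lemma scaled_vac_corange_sqr (a : R) :
  let C := bop_id F - a%:C *: vac_corange in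
  C \ob C = bop_id F - (1 - (1 - a) ^+ 2)%:C *: vac_corange.
Proof.
rewrite /= bop_compBl !bop_compBr !bop_comp1l bop_comp1r.
rewrite bop_compZl bop_compZr vac_corange_idem scalerA -!addrA; congr (_ + _).
rewrite -opprD -scalerBl -scalerDl; congr (- (_ *: _)).
by rewrite -!(rmorphM, rmorphB, rmorphD, rmorphN)/=; congr (_%:C); ring.
Qed.

(** On the range of the projection P the operator I - a P is multiplication by 1 - a, so a root of I
    - t P is obtained from 1 - a = sqrt(1 - t). *)
Lemma scaled_vac_corange_sqrt (t : R) : 0 <= t -> t <= 1 ->
  let C := bop_id F - (1 - Num.sqrt (1 - t))%:C *: vac_corange in
  [/\ C \ob C = bop_id F - t%:C *: vac_corange & adj C = C].
Proof.
move=> t0 t1; split.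
  rewrite scaled_vac_corange_sqr subKr sqr_sqrtr ?subr_ge0// subKr//.
rewrite adjB adj_id adjZ adj_vac_corange; congr (_ - _ *: _).
by rewrite conj_real.
Qed.

Lemma defect_scaled_creation (s : R) : 0 <= s -> s <= 1 ->
  let X := scaled_creation e F s in
  bop_le 0 (defect X) /\
  defect X \ob defect X = bop_id F - \sum_i X i \ob adj (X i).
Proof.
move=> s0 s1 X.
have XX : \sum_i X i \ob adj (X i) = (s ^+ 2)%:C *: vac_corange.
  rewrite scaler_sumr; apply: eq_bigr => i _.
  rewrite /X /scaled_creation adjZ bop_compZl bop_compZr scalerA; congr (_ *: _).
  by rewrite conj_real expr2 [RHS]rmorphM.
have ss : s ^+ 2 <= 1 by rewrite expr_le1.
(* I - d P is a root of I - s^2 P; taking a root once more writes it as the square of a self-adjoint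
   operator, hence it is positive. *)
pose d := 1 - Num.sqrt (1 - s ^+ 2).
have sq1 : Num.sqrt (1 - s ^+ 2) <= 1.
  by rewrite -[leRHS]sqrtr1 ler_wsqrtr// gerBl sqr_ge0.
have sq0 := sqrtr_ge0 (1 - s ^+ 2).
have d0 : 0 <= d by rewrite /d; lra.
have d1 : d <= 1 by rewrite /d; lra.
have [DD Da] := scaled_vac_corange_sqrt (sqr_ge0 s) ss.
have [CC Ca] := scaled_vac_corange_sqrt d0 d1.
rewrite /defect /bop_sqrt XX; case: xgetP => [D _ //|/(_ (bop_id F - d%:C *: vac_corange))].
by case; split=> // x; rewrite -CC bop0E hdot0l bop_compE adjP Ca hdot_nrm ler0c sqr_ge0.
Qed.

End fock.

(** * The Poisson kernel of a strict row contraction *)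

Section poisson_kernel.
Context {R : realType} {T : tensor_product R} {n : nat} {Hn : hilbertType R}.
Context {e : 'I_n -> Hn} (basis_e : orthonormal_basis e) (F : fock_space T Hn).
Context {H : hilbertType R} (X : 'I_n -> 'B(H, H)) (rho : R).
Hypothesis rho_ge0 : 0 <= rho.
Hypothesis rho_lt1 : rho < 1.
Hypothesis X_contraction :
  forall h, \sum_i nrm (adj (X i) h) ^+ 2 <= rho ^+ 2 * nrm h ^+ 2.
Hypothesis defect_ge0 : bop_le 0 (defect X).
Hypothesis defect_sqr :
  defect X \ob defect X = bop_id H - \sum_i X i \ob adj (X i).

Local Notation RI i := (bop_tens T (right_creation e F i) (bop_id H)).

Lemma nrm_sqr_defect h :
  nrm (defect X h) ^+ 2 = nrm h ^+ 2 - \sum_i nrm (adj (X i) h) ^+ 2.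
Proof.
rewrite nrm_sqr adjPr -bop_compE positive_selfadjoint// defect_sqr.
rewrite bopBE hdotBl raddfB/= -nrm_sqr bop_sumE hdot_suml raddf_sum/=.
by congr (_ - _); apply: eq_bigr => i _; rewrite adjP -nrm_sqr.
Qed.

(* The k-th term is the sum over the words of length k in the definition of
   [poisson_kernel], and the remainder is the sum of the |X_w^* h|^2 over the
   words w of length k. *)
Fixpoint poisson_term (k : nat) : 'B(H, tens T F H) :=
  if k is k'.+1 then \sum_i RI i \ob poisson_term k' \ob adj (X i)
  else tmulL T H (fock_vac F) \ob defect X.

Fixpoint poisson_remainder (k : nat) (h : H) : R :=
  if k is k'.+1 then \sum_i poisson_remainder k' (adj (X i) h) else nrm h ^+ 2.

Lemma poisson_termS k :
  poisson_term k.+1 = \sum_i RI i \ob poisson_term k \ob adj (X i).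
Proof. by []. Qed.

(** The recursion strips the first letter: X_{iw}^* = X_w^* X_i^*, while the reversed word gains i
    at its end. *)
Lemma poisson_termE k h : poisson_term k h =
  \sum_(w : k.-tuple 'I_n)
    tmul T F H (fock_basis e F (rev w)) (defect X (adj (bop_word X w) h)).
Proof.
elim: k h => [|k IH] h.
  rewrite (sum_tuple0 (fun w => tmul T F H (fock_basis e F (rev w))
    (defect X (adj (bop_word X w) h)))).
  by rewrite /= adj_id.
rewrite (sum_tupleS k (fun w => tmul T F H (fock_basis e F (rev w))
  (defect X (adj (bop_word X w) h)))).
rewrite poisson_termS bop_sumE; apply: eq_bigr => i _; rewrite !bop_compE IH linear_sum.
apply: eq_bigr => w _; rewrite /= bop_tensE bop_idE adj_comp.
by rewrite rev_cons fock_basis_rcons.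
Qed.

(** The R_i (x) I are isometries with orthogonal ranges, so each letter costs a factor rho. The
    series thus converges in norm, whereas [poisson_kernel] asks for pointwise convergence. *)
Lemma opnorm_poisson_term k : opnorm (poisson_term k) <= rho ^+ k.
Proof.
apply: opnorm_le => [|h]; first exact: exprn_ge0.
elim: k h => [|k IH] h.
  rewrite expr0 mul1r bop_compE tmulLE (tensorial_nrm _ _ (tmul_tensorial T F H)).
  have -> : nrm (fock_vac F) = 1.
    apply/eqP; rewrite -(@eqrXn2 _ 2) ?nrm_ge0//.
    by rewrite expr1n nrm_sqr hdot_vac.
  rewrite mul1r -(@ler_pXn2r _ 2) ?nnegrE ?nrm_ge0// nrm_sqr_defect gerBl.
  by rewrite sumr_ge0// => i _; rewrite sqr_ge0.
rewrite -(@ler_pXn2r _ 2) ?nnegrE ?mulr_ge0 ?exprn_ge0 ?nrm_ge0//.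
rewrite poisson_termS bop_sumE; under eq_bigr => i _ do rewrite 2!bop_compE.
rewrite (nrm_sqr_sum_creation basis_e) exprMn [rho ^+ k.+1]exprSr exprMn -mulrA.
apply: le_trans (_ : (rho ^+ k) ^+ 2 * \sum_i nrm (adj (X i) h) ^+ 2 <= _).
  rewrite mulr_sumr ler_sum// => i _; rewrite -exprMn.
  by rewrite ler_pXn2r ?nnegrE ?mulr_ge0 ?exprn_ge0 ?nrm_ge0.
by rewrite ler_wpM2l ?sqr_ge0.
Qed.

Lemma poisson_remainder_ge0 k h : 0 <= poisson_remainder k h.
Proof.
elim: k h => [|k IH] h /=; first exact: sqr_ge0.
by rewrite sumr_ge0.
Qed.

Lemma poisson_remainder_le k h :
  poisson_remainder k h <= nrm h ^+ 2 * (rho ^+ 2) ^+ k.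
Proof.
elim: k h => [|k IH] h /=; first by rewrite expr0 mulr1.
apply: le_trans (ler_sum _ (fun i _ => IH (adj (X i) h))) _.
rewrite -mulr_suml [_ ^+ k.+1]exprS mulrA ler_wpM2r ?exprn_ge0//.
by rewrite [leRHS]mulrC.
Qed.

(** Finite form of the equation K = 1 (x) Delta + sum of (R_i (x) I) K X_i^*, exact because of the
    shift from N to N + 1. *)
Lemma poisson_sumS N : \sum_(k < N.+1) poisson_term k =
  tmulL T H (fock_vac F) \ob defect X +
  \sum_i RI i \ob (\sum_(k < N) poisson_term k) \ob adj (X i).
Proof.
rewrite big_ord_recl /=; congr (_ + _); rewrite exchange_big/=.
by apply: eq_bigr => i _; rewrite bop_comp_sumr bop_comp_suml.
Qed.

(** The balance |h|^2 = |Delta h|^2 + sum of |X_i^* h|^2, iterated N times along the orthogonal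
    decomposition [poisson_sumS]. *)
Lemma nrm_sqr_poisson_sum N h :
  nrm ((\sum_(k < N) poisson_term k) h) ^+ 2 = nrm h ^+ 2 - poisson_remainder N h.
Proof.
elim: N h => [|N IH] h; first by rewrite big_ord0 bop0E nrm0 expr0n subrr.
rewrite poisson_sumS bopDE bop_sumE; under eq_bigr => i _ do rewrite 2!bop_compE.
rewrite bop_compE tmulLE (nrm_sqr_vac_creation basis_e) nrm_sqr_defect /=.
under [X in _ + X]eq_bigr => i _ do rewrite IH.
by rewrite sumrB; ring.
Qed.

Lemma poisson_kernel_cvg :
  opcvg (fun N => \sum_(k < N) poisson_term k) (poisson_kernel e F X).
Proof.
have [|L LP] := @bop_series_cvg _ _ _ poisson_term 1 rho rho_ge0 rho_lt1.
  by move=> k; rewrite mul1r opnorm_poisson_term.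
have sumE N h : (\sum_(k < N) poisson_term k) h = \sum_(k < N)
    \sum_(w : k.-tuple 'I_n)
    tmul T F H (fock_basis e F (rev w)) (defect X (adj (bop_word X w) h)).
  by rewrite bop_sumE; apply: eq_bigr => k _; rewrite poisson_termE.
have PL h : \sum_(k < N) \sum_(w : k.-tuple 'I_n)
    tmul T F H (fock_basis e F (rev w)) (defect X (adj (bop_word X w) h))
    @[N --> \oo] --> L h.
  apply/cvg_vanishes; apply: vanishes_le (opcvg_app h LP) => N.
  by rewrite sumE.
rewrite /poisson_kernel; case: xgetP => [K _ PK|/(_ L)//].
suff -> : K = L by [].
apply: bop_ext => h; apply/eqP; rewrite -subr_eq0; apply/eqP.
have /cvg_vanishes hK := PK h; have /cvg_vanishes hL := PL h.
apply: (nrm_vanishes0 (vanishesD hK hL)) => N.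
by rewrite [X in _ <= X + _]nrmC nrm_triangle.
Qed.

Lemma poisson_kernel_isometry :
  adj (poisson_kernel e F X) \ob poisson_kernel e F X = bop_id H.
Proof.
apply: isometry_adjK => h; set K := poisson_kernel e F X.
pose S N := \sum_(k < N) poisson_term k.
have vS : vanishes (fun N => nrm (S N h - K h)).
  exact: opcvg_app poisson_kernel_cvg.
have S_le N : nrm (S N h) <= nrm h.
  rewrite -(@ler_pXn2r _ 2) ?nnegrE ?nrm_ge0// nrm_sqr_poisson_sum gerBl.
  exact: poisson_remainder_ge0.
apply/eqP; rewrite eq_le; apply/andP; split.
  apply: (le_vanishes vS) => N; rewrite addrC nrmC.
  by apply: (le_trans (nrmB_ge _ (S N h))); rewrite lerD2l.
have [->|h0] := eqVneq (nrm h) 0; first exact: nrm_ge0.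
have hp : 0 < nrm h by rewrite lt_neqAle nrm_ge0 eq_sym h0.
(* After multiplication by |h| the estimate is linear in |S_N h|: |h|^2 = |S_N h|^2 + remainder <=
   |h| |S_N h| + remainder. *)
rewrite -(ler_pM2l hp) -expr2.
have rho2 : rho ^+ 2 < 1 by rewrite expr_lt1.
have vr := vanishes_geometric (nrm h ^+ 2) (sqr_ge0 rho) rho2.
apply: (le_vanishes (vanishesD (vanishesZ (nrm_ge0 h) vS) vr)) => N.
have := nrm_sqr_poisson_sum N h; have := poisson_remainder_le N h.
have := nrmB_ge (S N h) (K h); have := S_le N; have := nrm_ge0 (S N h).
rewrite -/(S N); nra.
Qed.

(** R_i^* (x) I kills the vacuum term of partial sum N + 1 and selects the i-th summand, leaving
    partial sum N composed with X_i^*. *)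
Lemma adj_right_creation_poisson_kernel i :
  adj (RI i) \ob poisson_kernel e F X = poisson_kernel e F X \ob adj (X i).
Proof.
apply: opcvg_unique (opcvgS (opcvg_compl _ poisson_kernel_cvg)) _.
have := opcvg_compr (adj (X i)) poisson_kernel_cvg.
rewrite (_ : (fun k => _) = (fun k => adj (RI i) \ob
  \sum_(j < k.+1) poisson_term j))//; apply/funext => N.
rewrite poisson_sumS; move: (\sum_(k < N) poisson_term k) => S.
rewrite bop_compDr -bop_compA adj_right_creation_tens_vac// bop_comp0l add0r.
rewrite bop_comp_sumr (bigD1 i)//= big1 ?addr0 => [|j ji].
  by rewrite -!bop_compA right_creation_tens_orth// eqxx scale1r bop_comp1l.
by rewrite -!bop_compA right_creation_tens_orth// eq_sym (negPf ji) scale0r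
  !bop_comp0l.
Qed.

Lemma poisson_kernel_right_creation i :
  adj (poisson_kernel e F X) \ob RI i = X i \ob adj (poisson_kernel e F X).
Proof.
have := congr1 (@adj _ _ _) (adj_right_creation_poisson_kernel i).
by rewrite !adj_comp !adjK.
Qed.

(** K^* moves past the letters one at a time, turning each R_i (x) I into X_i, and K^* K = I absorbs
    what is left. *)
Lemma poisson_kernel_word w :
  adj (poisson_kernel e F X) \ob
    bop_tens T (bop_word (right_creation e F) w) (bop_id H) \ob
    poisson_kernel e F X = bop_word X w.
Proof.
suff -> : adj (poisson_kernel e F X) \ob
    bop_tens T (bop_word (right_creation e F) w) (bop_id H) =
    bop_word X w \ob adj (poisson_kernel e F X).
  by rewrite bop_compA poisson_kernel_isometry bop_comp1r.
elim: w => [|i w IH] /=; first by rewrite bop_tens_id bop_comp1l bop_comp1r.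
rewrite -[X in bop_tens T _ X](bop_comp1l) -bop_tens_comp -bop_compA.
by rewrite poisson_kernel_right_creation bop_compA IH bop_compA.
Qed.

End poisson_kernel.
(** * Free holomorphic functions *)

Section homogeneous.
Context {R : realType} {T : tensor_product R} {n : nat} {Hn : hilbertType R}.
Context {e : 'I_n -> Hn} (basis_e : orthonormal_basis e) (F : fock_space T Hn).

Local Notation Rc := (right_creation e F).

Lemma scaled_creation_word (r : R) w :
  bop_word (scaled_creation e F r) w = (r ^+ size w)%:C *: bop_word Rc w.
Proof.
elim: w => [|i w IH] /=; first by rewrite expr0 scale1r.
by rewrite IH /scaled_creation bop_compZl bop_compZr scalerA exprS rmorphM.
Qed.

Lemma sum_adj_scaled_creation (r : R) h :
  \sum_i nrm (adj (scaled_creation e F r i) h) ^+ 2 <= r ^+ 2 * nrm h ^+ 2.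
Proof.
under eq_bigr => i _ do
  rewrite adjZ conj_real bopZE nrmZ nrm_real exprMn real_normK ?num_real//.
by rewrite -mulr_sumr ler_wpM2l ?sqr_ge0 ?sum_adj_right_creation.
Qed.

Lemma right_creation_word_orth v w : size v = size w ->
  adj (bop_word Rc v) \ob bop_word Rc w = (v == w)%:R *: bop_id F.
Proof.
elim: v w => [|i v IH] [|j w]//=; first by rewrite adj_id bop_comp1l scale1r.
move=> [/IH vw]; rewrite adj_comp bop_compA -[adj (Rc i) \ob (_ \ob _)]bop_compA.
rewrite right_creation_orth// bop_compZl bop_compZr bop_comp1l vw scalerA.
by rewrite eqseq_cons -natrM mulnb.
Qed.

Context {E Y : hilbertType R} (A : seq 'I_n -> 'B(E, Y)).

Definition homogeneous_part (r : R) (k : nat) : 'B(tens T E F, tens T Y F) :=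
  \sum_(w : k.-tuple 'I_n) bop_tens T (A w) (bop_word (scaled_creation e F r) w).

(** The R_w of equal length are isometries with orthogonal ranges, so the Gram operator is r^(2k)
    (sum of A_w^* A_w) (x) I. This is where the sum in the growth condition comes from. *)
Lemma opnorm_homogeneous_part (r : R) k : 0 <= r ->
  opnorm (homogeneous_part r k) <=
  r ^+ k * Num.sqrt (opnorm (\sum_(w : k.-tuple 'I_n) adj (A w) \ob A w)).
Proof.
move=> r0; set B := \sum_w _; have B0 := opnorm_ge0 B.
rewrite -(@ler_pXn2r _ 2) ?nnegrE ?mulr_ge0 ?exprn_ge0 ?sqrtr_ge0 ?opnorm_ge0//.
rewrite exprMn sqr_sqrtr//; apply: le_trans (opnorm_sqr _) _.
have -> : homogeneous_part r k = (r ^+ k)%:C *: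
    \sum_(w : k.-tuple 'I_n) bop_tens T (A w) (bop_word Rc w).
  rewrite scaler_sumr; apply: eq_bigr => w _.
  by rewrite scaled_creation_word size_tuple bop_tensZr.
set D := \sum_w _; have DD : adj D \ob D = bop_tens T B (bop_id F).
  rewrite adj_sum bop_comp_suml bop_tens_suml; apply: eq_bigr => v _.
  rewrite bop_comp_sumr (bigD1 v)//= big1 ?addr0 => [|w wv].
    rewrite adj_tens bop_tens_comp right_creation_word_orth// eqxx.
    by rewrite scale1r.
  rewrite adj_tens bop_tens_comp right_creation_word_orth ?size_tuple//.
  by rewrite eq_sym -val_eqE/= in wv; rewrite (negPf wv) scale0r bop_tens0r.
rewrite adjZ conj_real bop_compZl bop_compZr scalerA DD.
apply: opnorm_le => [|x]; first by rewrite mulr_ge0 ?sqr_ge0.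
rewrite bopZE nrmZ nrmM nrm_real ger0_norm ?exprn_ge0// -mulrA [leLHS]mulrA.
rewrite -expr2 -[leRHS]mulrA ler_wpM2l ?sqr_ge0// (le_trans (nrm_bop _ _))//.
by rewrite ler_wpM2r ?nrm_ge0 ?opnorm_tens_id.
Qed.

(** Hadamard's argument: eventually the 2k-th root of B_k is below t, hence sqrt(B_k) is below
    t^k. *)
Lemma free_growth_bound (t : R) : free_growth A -> 1 < t ->
  exists C : R, forall k, Num.sqrt
    (opnorm (\sum_(w : k.-tuple 'I_n) adj (A w) \ob A w)) <= C * t ^+ k.
Proof.
move=> Ag t1; set B := fun k => opnorm (\sum_(w : k.-tuple 'I_n) adj (A w) \ob A w).
have t1E : (1 < t%:E)%E by rewrite lte_fin.
have [N NB] := limn_esup_lt Ag t1E.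
have tk k : 1 <= t ^+ k by rewrite exprn_ege1// ltW.
(* The finite sum covers the first terms, including k = 0 where the exponent degenerates; the 1
   covers the tail. *)
pose C := 1 + \sum_(k < N.+1) Num.sqrt (B k).
have C_ge : 0 <= \sum_(k < N.+1) Num.sqrt (B k) by rewrite sumr_ge0.
exists C => k; have [kN|Nk] := leqP k N.
  have h1 : Num.sqrt (B k) <= C.
    rewrite /C (bigD1 (Ordinal (kN : (k < N.+1)%N)))//= addrCA lerDl.
    by rewrite addr_ge0 ?sumr_ge0.
  apply: (le_trans h1); rewrite ler_peMr//.
  by apply: le_trans h1; exact: sqrtr_ge0.
have := NB k (ltnW Nk); rewrite lte_fin -/(B k) => Bt.
have B0 : 0 <= B k by exact: opnorm_ge0.
have k0 : (0 < 2 * k)%N by rewrite muln_gt0/=; exact: leq_ltn_trans Nk.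
apply: (@le_trans _ _ (t ^+ k)); last first.
  rewrite ler_peMl ?(le_trans ler01 (tk k))// /C lerDl; exact: C_ge.
rewrite -[leRHS]ger0_norm ?(le_trans ler01 (tk k))// -sqrtr_sqr ler_wsqrtr//.
have -> : B k = (B k `^ ((2 * k)%:R^-1)) ^+ (2 * k).
  rewrite -powR_mulrn ?powR_ge0// -powRrM mulVf ?powRr1// pnatr_eq0.
  by rewrite -lt0n.
rewrite -exprM (mulnC k 2); apply: lerXn2r; rewrite ?nnegrE ?powR_ge0 ?ltW//.
exact: lt_trans t1.
Qed.

Lemma free_series_cvg (r : R) : free_growth A -> 0 <= r -> r < 1 ->
  exists L, opcvg (free_series T A (scaled_creation e F r)) L.
Proof.
(* What matters is t > 1 and r t < 1; both hold for 2 / (1 + r) since r < 1. *)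
move=> Ag r0 r1; have [|C CP] := free_growth_bound (t := 2 / (1 + r)) Ag.
  by rewrite ltr_pdivlMr; lra.
apply: (@bop_series_cvg _ _ _ (homogeneous_part r) C (2 * r / (1 + r))).
- by rewrite divr_ge0; lra.
- by rewrite ltr_pdivrMr; lra.
move=> k; apply: (le_trans (opnorm_homogeneous_part _ r0)).
have -> : 2 * r / (1 + r) = r * (2 / (1 + r)) by rewrite mulrAC mulrC.
by rewrite exprMn mulrCA ler_wpM2l ?exprn_ge0.
Qed.

End homogeneous.

(** * The Poisson transform as compression of a dilation *)

Section poisson_transform.
Context {R : realType} {T : tensor_product R} {n : nat} {Hn : hilbertType R}.
Context {e : 'I_n -> Hn} (basis_e : orthonormal_basis e) (F : fock_space T Hn).
Context (s : R) (s_ge0 : 0 <= s) (s_lt1 : s < 1).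
Implicit Types E Y : hilbertType R.

Local Notation X := (scaled_creation e F s).
Local Notation PK := (poisson_kernel e F X).

(** The isometry V of the overview; the associator brings its values into (E (x) F) (x) F, where the
    operators u (x) I act. *)
Definition poisson_dilation E : 'B(tens T E F, tens T (tens T E F) F) :=
  tens_assoc T E F F \ob bop_tens T (bop_id E) PK.

Lemma poissonE E (u : 'B(tens T E F, tens T E F)) :
  poisson e X u = adj (poisson_dilation E) \ob bop_tens T u (bop_id F) \ob
    poisson_dilation E.
Proof.
rewrite /poisson /poisson_dilation adj_comp adj_tens adj_id tens_assocVE.
by rewrite !bop_compA.
Qed.

Lemma poisson_le E (u v : 'B(tens T E F, tens T E F)) :
  bop_le u v -> bop_le (poisson e X u) (poisson e X v).
Proof.
move=> uv x; rewrite !poissonE -subr_ge0 -hdotBl -bopBE -bop_compBl -bop_compBr.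
rewrite -bop_tensBl !bop_compE -adjPr.
have /bop_tens_ge0 : bop_le 0 (v - u).
  by move=> y; rewrite bop0E hdot0l bopBE hdotBl subr_ge0.
by move=> /(_ T F (poisson_dilation E x)); rewrite bop0E hdot0l.
Qed.

Lemma scaled_creation_poisson_word w :
  adj PK \ob bop_tens T (bop_word (right_creation e F) w) (bop_id F) \ob PK =
  bop_word X w.
Proof.
have [D0 DD] := defect_scaled_creation basis_e F s_ge0 (ltW s_lt1).
apply: (poisson_kernel_word basis_e F s_ge0 s_lt1) => //.
exact: sum_adj_scaled_creation.
Qed.

Lemma poisson_dilation_isometry E :
  adj (poisson_dilation E) \ob poisson_dilation E = bop_id _.
Proof.
have := scaled_creation_poisson_word [::].
rewrite /= bop_tens_id bop_comp1r => PP.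
rewrite /poisson_dilation adj_comp bop_compA -[adj (tens_assoc _ _ _ _) \ob _]bop_compA.
rewrite tens_assocK bop_comp1l adj_tens adj_id bop_tens_comp PP bop_comp1l.
exact: bop_tens_id.
Qed.

(** Naturality cancels the associators and leaves A (x) K^* (R_w (x) I) K up to the scalar g^|w|. As
    A maps E to Y, each space has its own dilation. *)
Lemma poisson_dilation_word E Y (A : 'B(E, Y)) (g : R) w :
  adj (poisson_dilation Y) \ob
    bop_tens T (bop_tens T A (bop_word (scaled_creation e F g) w)) (bop_id F) \ob
    poisson_dilation E =
  bop_tens T A (bop_word (scaled_creation e F (s * g)) w).
Proof.
rewrite /poisson_dilation adj_comp adj_tens adj_id !bop_compA.
rewrite -[bop_tens _ (bop_tens _ _ _) _ \ob _]bop_compA tens_assoc_nat.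
rewrite !bop_compA -[adj (tens_assoc _ _ _ _) \ob _]bop_compA tens_assocK.
rewrite bop_comp1l !bop_tens_comp bop_comp1l bop_comp1r.
rewrite -bop_compA [in LHS]scaled_creation_word bop_tensZl bop_compZr bop_compZl.
rewrite scaled_creation_poisson_word !scaled_creation_word scalerA exprMn mulrC.
by rewrite -rmorphM.
Qed.

Lemma poisson_dilation_series E Y (A : seq 'I_n -> 'B(E, Y)) (g : R) N :
  adj (poisson_dilation Y) \ob
    bop_tens T (free_series T A (scaled_creation e F g) N) (bop_id F) \ob
    poisson_dilation E =
  free_series T A (scaled_creation e F (s * g)) N.
Proof.
rewrite bop_tens_suml bop_comp_sumr bop_comp_suml; apply: eq_bigr => k _.
rewrite bop_tens_suml bop_comp_sumr bop_comp_suml; apply: eq_bigr => w _.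
exact: poisson_dilation_word.
Qed.

Lemma nrm_adj_poisson_dilation E z : nrm (adj (poisson_dilation E) z) <= nrm z.
Proof.
have V1 : opnorm (poisson_dilation E) <= 1.
  rewrite -(@ler_pXn2r _ 2) ?nnegrE ?opnorm_ge0// expr1n.
  apply: le_trans (opnorm_sqr _) _; rewrite poisson_dilation_isometry.
  exact: opnorm_id.
apply: (le_trans (nrm_bop _ _)); rewrite ler_piMl ?nrm_ge0//.
exact: le_trans (opnorm_adj _) V1.
Qed.

(* An isometry V satisfies V V* <= 1, so (V* L V)* (V* L V) <= V* L* L V. *)
Lemma poisson_gram_ge E Y (L : 'B(tens T E F, tens T Y F)) :
  let L' := adj (poisson_dilation Y) \ob bop_tens T L (bop_id F) \ob
    poisson_dilation E in
  bop_le (adj L' \ob L') (poisson e X (adj L \ob L)).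
Proof.
move=> L' x; rewrite nrm_adj_comp poissonE.
have -> : bop_tens T (adj L \ob L) (bop_id F) =
    adj (bop_tens T L (bop_id F)) \ob bop_tens T L (bop_id F).
  by rewrite adj_tens adj_id bop_tens_comp bop_comp1l.
rewrite -!bop_compA -adj_comp bop_compA nrm_adj_comp lecR.
rewrite ler_pXn2r ?nnegrE ?nrm_ge0// /L' !bop_compE.
exact: nrm_adj_poisson_dilation.
Qed.

End poisson_transform.

(** * Membership in the norm closure of harmonic polynomials *)

Section harmonic.
Context {R : realType} {T : tensor_product R} {n : nat} {Hn : hilbertType R}.
Context {e : 'I_n -> Hn} (basis_e : orthonormal_basis e) (F : fock_space T Hn).
Context {E : hilbertType R}.

Local Notation Rc := (right_creation e F).
Local Notation poly := (@creation_polynomials R T n Hn e F E).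

Definition harmonic_polynomials : set 'B(tens T E F, tens T E F) :=
  [set u | exists p q, [/\ poly p, poly q & u = adj p + q]].

Lemma creation_polynomials0 : poly 0.
Proof. by exists [::]; rewrite big_nil. Qed.

Lemma creation_polynomials_tens (B : 'B(E, E)) w :
  poly (bop_tens T B (bop_word Rc w)).
Proof. by exists [:: (B, w)]; rewrite big_seq1. Qed.

Lemma creation_polynomialsD p q : poly p -> poly q -> poly (p + q).
Proof. by move=> [a ->] [b ->]; exists (a ++ b); rewrite big_cat. Qed.

Lemma harmonic_polynomials0 : harmonic_polynomials 0.
Proof.
exists 0, 0; split; rewrite ?adj0 ?addr0//; exact: creation_polynomials0.
Qed.

Lemma harmonic_polynomialsD u v :
  harmonic_polynomials u -> harmonic_polynomials v -> harmonic_polynomials (u + v).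
Proof.
move=> [p [q [pp pq ->]]] [p' [q' [pp' pq' ->]]]; exists (p + p'), (q + q').
split; [exact: creation_polynomialsD..|by rewrite adjD addrACA].
Qed.

Lemma harmonic_polynomials_sum (I : Type) (r : seq I) (P : pred I)
    (f : I -> 'B(tens T E F, tens T E F)) :
  (forall i, P i -> harmonic_polynomials (f i)) ->
  harmonic_polynomials (\sum_(i <- r | P i) f i).
Proof.
move=> fP; apply: big_ind => //; first exact: harmonic_polynomials0.
exact: harmonic_polynomialsD.
Qed.

(** By R_i^* R_j = delta_ij the first letters of v and w cancel or give 0, until one word is
    exhausted; what remains is a word or the adjoint of a word. *)
Lemma harmonic_polynomials_tens (B : 'B(E, E)) v w :
  harmonic_polynomials (bop_tens T B (adj (bop_word Rc v) \ob bop_word Rc w)).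
Proof.
elim: v w => [|i v IH] w.
  exists 0, (bop_tens T B (bop_word Rc w)).
  split; [exact: creation_polynomials0|exact: creation_polynomials_tens|].
  by rewrite /= adj_id bop_comp1l adj0 add0r.
case: w => [|j w].
  exists (bop_tens T (adj B) (bop_word Rc (i :: v))), 0.
  split; [exact: creation_polynomials_tens|exact: creation_polynomials0|].
  by rewrite adj_tens adjK addr0 bop_comp1r.
rewrite /= adj_comp bop_compA -[adj (Rc i) \ob (_ \ob _)]bop_compA.
rewrite right_creation_orth//; have [_|_] := eqVneq i j.
  by rewrite scale1r bop_comp1l.
rewrite scale0r bop_comp0l bop_comp0r bop_tens0r; exact: harmonic_polynomials0.
Qed.

Lemma harmonic_polynomials_gram {Y : hilbertType R} (A : seq 'I_n -> 'B(E, Y))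
    (r : R) N :
  let S := free_series T A (scaled_creation e F r) N in
  harmonic_polynomials (adj S \ob S).
Proof.
move=> S; rewrite adj_sum bop_comp_suml; apply: harmonic_polynomials_sum => k _.
rewrite adj_sum bop_comp_suml; apply: harmonic_polynomials_sum => v _.
rewrite bop_comp_sumr; apply: harmonic_polynomials_sum => l _.
rewrite bop_comp_sumr; apply: harmonic_polynomials_sum => w _.
rewrite adj_tens bop_tens_comp !scaled_creation_word adjZ bop_compZl bop_compZr.
(* The scalars r^|v| and r^|w| join the coefficient A_v^* A_w. *)
by rewrite !bop_tensZr -!bop_tensZl; exact: harmonic_polynomials_tens.
Qed.

Lemma harmonic_operators_lim (u : nat -> 'B(tens T E F, tens T E F)) v :
  (forall k, harmonic_polynomials (u k)) -> opcvg u v -> harmonic_operators e v.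
Proof.
move=> uh /opcvgP uv eps /uv[N /(_ _ (leqnn N)) uN].
have [p [q [pp pq uE]]] := uh N; exists p, q; split=> //.
by rewrite -uE opnormC.
Qed.

End harmonic.

Lemma opcvg_tensl (R : realType) (T : tensor_product R) (H H' K : hilbertType R)
    (A : nat -> 'B(H, H')) L :
  opcvg A L ->
  opcvg (fun k => bop_tens T (A k) (bop_id K)) (bop_tens T L (bop_id K)).
Proof.
move=> /opcvgP AL; apply/opcvgP; apply: vanishes_le AL => k.
by rewrite -bop_tensBl opnorm_tens_id.
Qed.

(** [free_mapE] concerns operators on H; on the Fock space convergence is derived from the growth of
    the coefficients. *)
Lemma free_eval_cvg (R : realType) (T : tensor_product R) (n : nat)
    (E Y H : hilbertType R) (Theta : free_holomorphic T n E Y H)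
    (Hn : hilbertType R) (e : 'I_n -> Hn) (basis_e : orthonormal_basis e)
    (F : fock_space T Hn) (r : R) : 0 <= r -> r < 1 ->
  opcvg (free_series T (free_coef Theta) (scaled_creation e F r))
        (free_eval Theta (scaled_creation e F r)).
Proof.
move=> r0 r1.
have [L LP] := free_series_cvg basis_e F (free_coef_growth Theta) r0 r1.
by rewrite /free_eval; case: xgetP => [//|/(_ L)].
Qed.

Theorem theorem2p2 (R : realType) (T : tensor_product R)
  (n : nat) (n_gt0 : (0 < n)%N)
  (E Y H : hilbertType R) (sepE : separable E)
  (infH : infinite_dimensional H)
  (Hn : hilbertType R) (e : 'I_n -> Hn) (basis_e : orthonormal_basis e)
  (F : fock_space T Hn)
  (Theta : free_holomorphic T n E Y H) :
  sub_pluriharmonic_curve e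
    (fun r : R => adj (free_eval Theta (scaled_creation e F r))
                  \ob free_eval Theta (scaled_creation e F r)).
Proof.
split=> [r /andP[r0 r1]|g /andP[g0 g1] phi [_ phi_harm] _ le_g r /andP[r0 rg]].
  split; last by rewrite adj_comp adjK.
  apply: harmonic_operators_lim (opcvg_gram (free_eval_cvg Theta basis_e F r0 r1)).
  by move=> N; exact: harmonic_polynomials_gram.
(* At r = g the conclusion is the hypothesis; below g the ratio r / g is an admissible dilation
   parameter. *)
have [->//|r_neq_g] := eqVneq r g.
have {r_neq_g}rg' : r < g by rewrite lt_neqAle r_neq_g.
have s0 : 0 <= r / g by rewrite divr_ge0// ltW.
have s1 : r / g < 1 by rewrite ltr_pdivrMr// mul1r.
have in_gr : `[0, g]%classic r by rewrite /= in_itv/= r0.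
have in_gg : `[0, g]%classic g by rewrite /= in_itv/= lexx ltW.
(* Partial sums at g are compressed exactly to partial sums at r = (r / g) g, and both sides pass to
   the norm limit. *)
have dilate : adj (poisson_dilation (e := e) F (r / g) Y) \ob
    bop_tens T (free_eval Theta (scaled_creation e F g)) (bop_id F) \ob
    poisson_dilation (e := e) F (r / g) E = free_eval Theta (scaled_creation e F r).
  have r1 := le_lt_trans rg g1.
  have seriesE N : adj (poisson_dilation (e := e) F (r / g) Y) \ob
      bop_tens T (free_series T (free_coef Theta) (scaled_creation e F g) N)
        (bop_id F) \ob poisson_dilation (e := e) F (r / g) E =
      free_series T (free_coef Theta) (scaled_creation e F r) N.
    by rewrite poisson_dilation_series// divfK// gt_eqF.
  apply: opcvg_unique (free_eval_cvg Theta basis_e F r0 r1).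
  rewrite -(funext seriesE); apply/opcvg_compr/opcvg_compl/opcvg_tensl.
  exact: free_eval_cvg (ltW g0) g1.
have := poisson_gram_ge basis_e s0 s1 (free_eval Theta (scaled_creation e F g)).
rewrite /= dilate (phi_harm r g in_gr in_gg rg') => gram_le x.
by apply: (le_trans (gram_le x)); exact: poisson_le.
Qed.
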